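(* We have $$ \mathrm m((1+x_1)^2+x_2+x_3) =\frac{8\Gamma(\frac34)^2}{\pi^{5/2}}\, {}_5F_4\left(\tfrac14,\tfrac14,\tfrac14,\tfrac34,\tfrac34;\tfrac12,\tfrac54,\tfrac54,\tfrac54;\tfrac14\right) +\frac{\Gamma(\frac14)^2}{54\pi^{5/2}}\, {}_5F_4\left(\tfrac34,\tfrac34,\tfrac34,\tfrac54,\tfrac54;\tfrac32,\tfrac74,\tfrac74,\tfrac74;\tfrac14\right). $$
   Context: For a nonzero Laurent polynomial $P(x_1,\dots,x_N)$, $\mathrm m(P)=\int_{[0,1]^N}\log|P(e^{2\pi i\theta_1},\dots,e^{2\pi i\theta_N})|\,d\theta_1\cdots d\theta_N$ is its Mahler measure. The generalized hypergeometric series is ${}_5F_4(a_1,\dots,a_5;b_2,\dots,b_5;z)=\sum_{n\ge0}\frac{(a_1)_n\cdots(a_5)_n}{(b_2)_n\cdots(b_5)_n}\frac{z^n}{n!}$ with $(a)_n=\Gamma(a+n)/\Gamma(a)$. *)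

(* Defs.v *)
From mathcomp Require Import all_boot all_algebra.
From mathcomp Require Import all_classical all_reals all_analysis.
From mathcomp Require Import complex.
Import GRing.Theory Num.Theory numFieldNormedType.Exports.
Set Implicit Arguments. Unset Strict Implicit. Unset Printing Implicit Defensive.
Local Open Scope ring_scope.
Local Open Scope complex_scope.
Local Open Scope classical_set_scope.

Definition e2pi {R : realType} (t : R) : R[i] :=
  cos (2 * pi * t) +i* sin (2 * pi * t).

Definition mahler3 {R : realType} (P : R[i] -> R[i] -> R[i] -> R[i]) : \bar R :=
  (\int[(@lebesgue_measure R \x @lebesgue_measure R \x @lebesgue_measure R)%E]_(t in
      (`[0%R, 1%R] `*` `[0%R, 1%R]) `*` `[0%R, 1%R])
     (ln (Normc.normc (P (e2pi t.1.1) (e2pi t.1.2) (e2pi t.2))))%:E)%E.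

Definition Gamma {R : realType} (x : R) : R :=
  Rintegral lebesgue_measure `]0, +oo[ (fun t => t `^ (x - 1) * expR (- t)).

Definition poch {R : realType} (a : R) (n : nat) : R :=
  \prod_(i < n) (a + i%:R).

Definition hyp5F4 {R : realType} (a1 a2 a3 a4 a5 b2 b3 b4 b5 z : R) : R :=
  limn (series (fun n : nat =>
    (poch a1 n * poch a2 n * poch a3 n * poch a4 n * poch a5 n)
    / (poch b2 n * poch b3 n * poch b4 n * poch b5 n)
    * z ^+ n / n`!%:R)).

(* Main.v *)
(* Write e(t) = exp(2 pi i t). Jensen's formula, applied in t3, then backwards in
   t2, then once more after exchanging the integrals, gives
     int int ln |c + e(t2) + e(t3)| = int ln max(|c|, |1 + e(t3)|),
   so the Mahler measure is int int ln max(r^2, s) with r = |1 + e(t1)| and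
   s = |1 + e(t3)|, where |1 + e(t)| = 2 |cos (pi t)|. The law of r is an arcsine
   law; integrating its distribution function against dy / y gives
     int ln max(2 |cos (pi t)|, x)
       = sum_k (2 / pi) b_k (x / 2)^(2k+1) / (2k+1)^2,   b_k = (1/2)_k / k!.
   At x = sqrt s, a further integration in t3 yields a series in the moments of
   |cos| of order k + 1/2. These are Beta values, whence a two-step recurrence in
   k: the even and odd terms form the two hypergeometric series, and the moments
   at k = 0, 1 give the Gamma factors.
   All integrals are taken of [k - ln ...] >= 0, so that Tonelli's theorem and
   monotone convergence apply without integrability hypotheses. *)
From HB Require Import structures.
Require Import Defs.
From mathcomp Require Import all_boot all_order all_algebra.
From mathcomp Require Import all_classical all_reals all_analysis.
From mathcomp Require Import measurable_realfun complex.
From mathcomp Require Import ring lra.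
Import Order.TTheory GRing.Theory Num.Theory numFieldNormedType.Exports.
Set Implicit Arguments. Unset Strict Implicit. Unset Printing Implicit Defensive.
Local Open Scope ring_scope.
Local Open Scope complex_scope.
Local Open Scope classical_set_scope.

(** * Integration and the unit circle *)

(** Since [ln 0 = 0], the rule ln (x y) = ln x + ln y and the value -oo at a zero both fail on the
    zero set of a polynomial; that set meets a period in at most one point, so identities are proved
    off it and integrated by almost-everywhere equality. The constant 6 bounds |1 + x1|^2 + |x2| +
    |x3| <= 4 + 1 + 1, and ln x <= x makes it bound the logarithms as well; it cancels at the end.
    The constant ln 2 in the expansion of int ln max(2 |cos (pi t)|, x) is not computed from the
    arcsine integral: at x = 0 it is Jensen's formula on the unit circle. Of the Beta function only
    the diagonal is used, Gamma(a)^2 = B(a, a) Gamma(2 a). Here 2 a is a half-integer, so Gamma(2 a)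
    is a rational multiple of sqrt pi, and the moments of |cos| never have to be evaluated: those of
    order 1/2 and 3/2 cancel against Gamma(3/4)^2 and Gamma(1/4)^2. The argument 1/4 of the
    hypergeometric series is 2^(-4) from two steps of the arcsine coefficients times 2^2 from two
    steps of the moments of 2 |cos|. *)

Section tonelli_on.
Context d1 d2 (T1 : measurableType d1) (T2 : measurableType d2) (R : realType).
Variables (m1 : {sigma_finite_measure set T1 -> \bar R}).
Variables (m2 : {sigma_finite_measure set T2 -> \bar R}).
Variables (A : set T1) (B : set T2) (f : T1 * T2 -> \bar R).
Hypotheses (mA : measurable A) (mB : measurable B).
Hypotheses (mf : measurable_fun setT f) (f0 : forall x, (0 <= f x)%E).
Local Open Scope ereal_scope.

(** Extension by zero turns integrals over [A] and [B] into integrals over the whole spaces, where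
    Tonelli's theorem is stated. *)
Let g := f \_ (A `*` B).

Let mg : measurable_fun setT g.
Proof.
apply/(measurable_restrictT _ _).1; first exact: measurableX.
exact: measurable_funTS.
Qed.

Let g0 x : 0 <= g x.
Proof. by rewrite /g patchE; case: ifP. Qed.

Let gE x y : g (x, y) = ((fun x => ((fun y => f (x, y)) \_ B) y) \_ A) x.
Proof.
rewrite /g !patchE.
have -> : ((x, y) \in A `*` B) = (x \in A) && (y \in B).
  by apply/idP/andP; rewrite !inE.
by case: (x \in A).
Qed.

Let int_gx x : \int[m2]_y g (x, y) = ((fun x => \int[m2]_(y in B) f (x, y)) \_ A) x.
Proof.
rewrite patchE; case: ifPn => xA.
  by rewrite [RHS]integral_mkcond; apply: eq_integral => y _; rewrite gE patchE xA.
by rewrite integral0_eq// => y _; rewrite gE patchE (negbTE xA).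
Qed.

Let int_gy y : \int[m1]_x g (x, y) = ((fun y => \int[m1]_(x in A) f (x, y)) \_ B) y.
Proof.
rewrite patchE; case: ifPn => yB.
  rewrite [RHS]integral_mkcond; apply: eq_integral => x _.
  by rewrite gE !patchE yB.
by rewrite integral0_eq// => x _; rewrite gE !patchE (negbTE yB); case: ifP.
Qed.

Lemma ge0_integral_prod_swap :
  \int[m1]_(x in A) \int[m2]_(y in B) f (x, y) =
  \int[m2]_(y in B) \int[m1]_(x in A) f (x, y).
Proof.
rewrite [LHS]integral_mkcond [RHS]integral_mkcond.
under eq_integral do rewrite -int_gx.
under [RHS]eq_integral do rewrite -int_gy.
exact: fubini_tonelli.
Qed.

Lemma ge0_integral_prod1 :
  \int[m1 \x m2]_(z in A `*` B) f z = \int[m1]_(x in A) \int[m2]_(y in B) f (x, y).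
Proof.
rewrite [LHS]integral_mkcond -/g fubini_tonelli1//= [RHS]integral_mkcond.
by apply: eq_integral => x _; exact: int_gx.
Qed.

Lemma ge0_integral_prod_measurable :
  measurable_fun setT (fun x => \int[m2]_(y in B) f (x, y)).
Proof.
have mfB : measurable_fun setT (f \_ (setT `*` B)).
  apply/(measurable_restrictT _ _).1; first exact: measurableX.
  exact: measurable_funTS.
have fB0 x : 0 <= (f \_ (setT `*` B)) x by rewrite patchE; case: ifP.
have := @measurable_fun_fubini_tonelli_F _ _ _ _ _ m2 _ mfB fB0.
congr measurable_fun; apply/funext => x; rewrite /fubini_F [RHS]integral_mkcond.
apply: eq_integral => y _; rewrite !patchE.
have -> // : ((x, y) \in [set: T1] `*` B) = (y \in B).
by apply/idP/idP; rewrite !inE => //= -[].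
Qed.

End tonelli_on.

Section affine.
Context {R : realType}.
Notation mu := (@lebesgue_measure R).
Variables (a b : R).
Hypothesis a0 : 0 < a.
Let phi (x : R) : measurableTypeR R := a * x + b.
Let mphi : measurable_fun setT phi.
Proof. by apply: measurable_funD => //; apply: measurable_funM. Qed.
Let nu : {measure set (measurableTypeR R) -> \bar R} :=
  measure_function_pushforward__canonical__measure_function_Measure mu mphi.

(** Lebesgue measure is determined by its values on half-open intervals, and there the push-forward
    by [phi] divides lengths by [a]. *)
Let phi_mu A : measurable A -> lebesgue_measure A = mscale (NngNum (ltW a0)) nu A.
Proof.
apply: lebesgue_measure_unique => _ [[x y]] _ <-.
change (mu `]x, y] = (a%:E * mu (phi @^-1` `]x, y])%classic)%E).
have -> : phi @^-1` `]x, y] = `](x - b) / a, (y - b) / a].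
  apply/seteqP; split => t /=; rewrite !in_itv/= /phi.
    by rewrite ltr_pdivrMr// ler_pdivlMr// ltrBlDr lerBrDr mulrC.
  by rewrite ltr_pdivrMr// ler_pdivlMr// ltrBlDr lerBrDr mulrC.
rewrite !lebesgue_measure_itv/= !lte_fin.
rewrite ltr_pM2r ?invr_gt0// ltrD2r; case: ifPn => _; last by rewrite mule0.
by rewrite -!EFinD -EFinM; congr EFin; field; rewrite gt_eqF.
Qed.

Lemma ge0_integral_affine (D : set R) (f : R -> \bar R) :
  measurable D -> measurable_fun D f -> (forall x, D x -> (0 <= f x)%E) ->
  (\int[mu]_(x in D) f x =
   a%:E * \int[mu]_(x in ((fun x : R => (a * x + b)%R) @^-1` D)) f (a * x + b)%R)%E.
Proof.
move=> mD mf f0.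
rewrite (@eq_measure_integral _ _ _ _ (mscale (NngNum (ltW a0)) nu)); last first.
  by move=> A mA _; exact: phi_mu.
rewrite ge0_integral_mscale//=; congr (_ * _)%E.
rewrite ge0_integral_pushforward// => y; rewrite inE; exact: f0.
Qed.

End affine.

Section complex_valued.
Context d (T : measurableType d) (R : realType).
Implicit Types f g : T -> R[i].

Definition cmeasurable f :=
  measurable_fun setT (fun x => complex.Re (f x)) /\
  measurable_fun setT (fun x => complex.Im (f x)).

Lemma cmeasurable_cst c : cmeasurable (fun=> c).
Proof. by split; exact: measurable_cst. Qed.

Lemma cmeasurableD f g : cmeasurable f -> cmeasurable g ->
  cmeasurable (fun x => f x + g x).
Proof.
move=> [rf jf] [rg jg]; split.
  rewrite (_ : (fun x => _) = (fun x => complex.Re (f x) + complex.Re (g x))).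
    exact: measurable_funD.
  by apply/funext => x; case: (f x) (g x) => ? ? [].
rewrite (_ : (fun x => _) = (fun x => complex.Im (f x) + complex.Im (g x))).
  exact: measurable_funD.
by apply/funext => x; case: (f x) (g x) => ? ? [].
Qed.

Lemma cmeasurableM f g : cmeasurable f -> cmeasurable g ->
  cmeasurable (fun x => f x * g x).
Proof.
move=> [rf jf] [rg jg]; split.
  rewrite (_ : (fun x => _) = (fun x => complex.Re (f x) * complex.Re (g x)
      - complex.Im (f x) * complex.Im (g x))).
    by apply: measurable_funB; exact: measurable_funM.
  by apply/funext => x; case: (f x) (g x) => ? ? [].
rewrite (_ : (fun x => _) = (fun x => complex.Re (f x) * complex.Im (g x)
    + complex.Im (f x) * complex.Re (g x))).
  by apply: measurable_funD; exact: measurable_funM.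
by apply/funext => x; case: (f x) (g x) => ? ? [].
Qed.

Lemma measurable_normc f : cmeasurable f ->
  measurable_fun setT (fun x => Normc.normc (f x)).
Proof.
move=> [rf jf].
rewrite (_ : (fun x => _) = (fun x => (complex.Re (f x) ^+ 2 + complex.Im (f x) ^+ 2) `^ 2^-1)).
  apply: (@measurableT_comp _ _ _ _ _ _ (@powR R ^~ 2^-1)) => //.
  by apply: measurable_funD; exact: measurable_funX.
apply/funext => x; case: (f x) => u v /=.
by rewrite powR12_sqrt// addr_ge0// sqr_ge0.
Qed.

Lemma cmeasurable_e2pi (h : T -> R) : measurable_fun setT h ->
  cmeasurable (fun x => e2pi (h x)).
Proof.
move=> mh; split => /=.
  apply: (@measurableT_comp _ _ _ _ _ _ (@cos R)).
    by apply: continuous_measurable_fun; exact: continuous_cos.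
  exact: measurable_funM.
apply: (@measurableT_comp _ _ _ _ _ _ (@sin R)).
    by apply: continuous_measurable_fun; exact: continuous_sin.
exact: measurable_funM.
Qed.

End complex_valued.

Section e2pi_theory.
Context {R : realType}.
Implicit Types (t s : R).

Lemma e2piD t s : e2pi (t + s) = e2pi t * e2pi s.
Proof. by rewrite /e2pi mulrDr cosD sinD; apply/eqP; rewrite eq_complex/= addrC eqxx addrC eqxx. Qed.

Lemma e2pi0 : e2pi (0 : R) = 1.
Proof. by rewrite /e2pi mulr0 cos0 sin0. Qed.

Lemma e2pi_half : e2pi (2^-1 : R) = -1.
Proof.
rewrite /e2pi (_ : 2 * pi * 2^-1 = pi); last by field.
by rewrite cospi sinpi; apply/eqP; rewrite eq_complex/= oppr0 !eqxx.
Qed.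

Lemma normc_e2pi t : Normc.normc (e2pi t) = 1.
Proof. by rewrite /= cos2Dsin2 sqrtr1. Qed.

Lemma e2piN t : e2pi (- t) = (e2pi t)^*.
Proof. by rewrite /e2pi mulrN cosN sinN. Qed.

Lemma e2pi_neq0 t : e2pi t != 0.
Proof.
apply/eqP => /(congr1 (@Normc.normc R)); rewrite normc_e2pi Normc.normc0 => /eqP.
by rewrite oner_eq0.
Qed.

(** By the double angle formula a real part 1 would force sin (pi t) = 0, but sine is positive
    inside ]0, pi[. *)
Lemma e2pi_eq1 t : 0 < t < 1 -> e2pi t != 1.
Proof.
move=> /andP[t0 t1]; apply/eqP => /(congr1 (@complex.Re R)) /=.
rewrite -mulrA mulr_natl cos_mulr2n => /eqP.
rewrite subr_eq -mulr2n eqrMn2r/= -subr_eq0 -[X in _ - X]opprK.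
rewrite opprK subr_eq0 => /eqP c1.
have : sin (pi * t) ^+ 2 == 0 by rewrite sin2cos2 c1 subrr.
apply/negP; rewrite sqrf_eq0 gt_eqF//.
apply: sin_gt0_pi; rewrite mulr_gt0 ?pi_gt0//=.
by rewrite -[ltRHS]mulr1 ltr_pM2l// pi_gt0.
Qed.

(** This is why Jensen's formula is first proved on the half-open interval: a linear polynomial then
    has at most one zero. *)
Lemma e2pi_inj : {in `[0, 1[%R &, injective (@e2pi R)}.
Proof.
move=> t s; wlog : t s / (t : R) <= s.
  move=> H tI sI E; have [ts|/ltW st] := leP t s; first exact: H.
  by apply/esym; apply: H.
rewrite le_eqVlt => /predU1P[//|ts].
move=> /[!in_itv]/= /andP[t0 t1] /andP[s0 s1] E.
have : e2pi (s - t) = 1.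
  apply: (mulfI (e2pi_neq0 t)).
  by rewrite -e2piD addrC subrK mulr1.
by apply: contra_eq => _; rewrite e2pi_eq1// subr_gt0 ts ltrBlDr (lt_le_trans s1)// lerDl.
Qed.

Lemma normc_onePe2pi t : Normc.normc (1 + e2pi t) = 2 * `|cos (pi * t)|.
Proof.
rewrite /= add0r (_ : 2 * pi * t = (pi * t) *+ 2); last by rewrite -mulrA mulr_natl.
rewrite cos_mulr2n sin_mulr2n (addrC 1) subrK.
rewrite (_ : _ + _ = (2 * cos (pi * t)) ^+ 2 * (cos (pi * t) ^+ 2 + sin (pi * t) ^+ 2)).
  by rewrite cos2Dsin2 mulr1 sqrtr_sqr normrM ger0_norm.
ring.
Qed.

End e2pi_theory.

Section ln_facts.
Context {R : realType}.
Implicit Types x y : R.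

(* Holds at [x = 0] as well, since [ln 0 = 0]. *)
Lemma ge0_le_ln x y : 0 <= x -> x <= y -> 1 <= y -> ln x <= ln y.
Proof.
rewrite le_eqVlt => /predU1P[<- _ y1|x0 xy y1]; first by rewrite ln0// ln_ge0.
by rewrite ler_ln// posrE (lt_le_trans x0).
Qed.

Lemma ge0_ln_le x : 0 <= x -> ln x <= x.
Proof.
rewrite le_eqVlt => /predU1P[<-|x0]; first by rewrite ln0.
exact/ltW/ln_sublinear.
Qed.

Lemma lnM_neq0 x y : 0 <= x -> 0 <= y -> x != 0 -> y != 0 -> ln (x * y) = ln x + ln y.
Proof. by move=> ? ? ? ?; rewrite lnM// posrE lt0r; apply/andP. Qed.

Lemma ge_limn_einf (u : (\bar R)^nat) a :
  (forall n, (a <= u n)%E) -> (a <= limn_einf u)%E.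
Proof.
move=> au; rewrite limn_einf_lim; apply: lime_ge; first exact: is_cvg_einfs.
by apply: nearW => n; apply: le_ereal_inf_tmp => _ [m _ <-].
Qed.

End ln_facts.

Lemma integral_itv_cst {R : realType} (b0 b1 : bool) (a b c : R) : a <= b ->
  (\int[@lebesgue_measure R]_(x in [set` Interval (BSide b0 a) (BSide b1 b)]) c%:E =
   (c * (b - a))%:E)%E.
Proof.
move=> ab; have := @integral_cst _ _ R (@lebesgue_measure R) _
  (measurable_itv (Interval (BSide b0 a) (BSide b1 b))) c%:E.
rewrite /cst => ->; rewrite -[X in (_ * X)%E]/(lebesgue_measure _) lebesgue_measure_itv/= lte_fin.
case: ltP => ba; first by rewrite -EFinD -EFinM.
by rewrite mule0 (_ : b = a) ?subrr ?mulr0//; apply/eqP; rewrite eq_le ba ab.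
Qed.

Section normc_facts.
Context {R : realType}.
Implicit Types z : R[i].

Lemma normc_ge0 z : 0 <= Normc.normc z.
Proof. by case: z => a b /=; exact: sqrtr_ge0. Qed.

Lemma normc_eq0 z : (Normc.normc z == 0) = (z == 0).
Proof.
by apply/eqP/eqP => [/Normc.eq0_normc//|->]; rewrite Normc.normc0.
Qed.

Lemma normc_conj z : Normc.normc (z^*)%C = Normc.normc z.
Proof. by case: z => a b /=; rewrite sqrrN. Qed.

Lemma conjcD z z' : conjc (z + z') = conjc z + conjc z'.
Proof. exact: rmorphD. Qed.

Lemma conjcM z z' : conjc (z * z') = conjc z * conjc z'.
Proof. exact: rmorphM. Qed.

Lemma normcD z z' : Normc.normc (z + z') <= Normc.normc z + Normc.normc z'.
Proof. exact: (@le_normcD R z z'). Qed.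

Lemma normcN z : Normc.normc (- z) = Normc.normc z.
Proof. by case: z => a b /=; rewrite !sqrrN. Qed.

Lemma normcX z n : Normc.normc (z ^+ n) = Normc.normc z ^+ n.
Proof.
by elim: n => [|n IH]; rewrite ?expr0 ?Normc.normc1// !exprS Normc.normcM IH.
Qed.

Lemma normc_real (r : R) : 0 <= r -> Normc.normc (r%:C)%C = r.
Proof. by move=> r0 /=; rewrite expr0n/= addr0 sqrtr_sqr ger0_norm. Qed.

End normc_facts.

(** * Jensen's formula for linear polynomials *)

Section jensen.
Context {R : realType}.
Notation mu := (@lebesgue_measure R).
Notation lnc z := (ln (Normc.normc z)).
Implicit Types w a b z : R[i].
Local Open Scope ereal_scope.

Lemma negligible_zeros a b : (a != 0%R) || (b != 0%R) ->
  mu.-negligible [set t | `[0%R, 1%R[ t /\ (a + b * e2pi t = 0)%R].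
Proof.
move=> ab0; set Z := [set t | _].
have [->|/set0P[t0 Zt0]] := eqVneq Z set0; first exact: negligible_set0.
apply: (@negligibleS _ _ _ mu [set t0] Z); last first.
  by apply/negligibleP; [exact: measurable_set1|exact: lebesgue_measure_set1].
move=> t [tI tZ]; case: Zt0 => t0I t0Z.
have b0 : (b != 0)%R.
  by apply: contra_eqN tZ => /eqP b0; move: ab0; rewrite b0 mul0r addr0 eqxx orbF.
apply: e2pi_inj; rewrite ?inE// ?in_setE//.
by apply: (mulfI b0); apply: (addrI a); rewrite tZ t0Z.
Qed.

Lemma measurable_lnc d (T : measurableType d) (f : T -> R[i]) (k : R) (D : set T) :
  cmeasurable f -> measurable_fun D (fun x => (k - lnc (f x))%:E).
Proof.
move=> mf; apply/measurable_funTS/measurable_EFinP.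
apply: measurable_funB => //; apply: measurableT_comp => //.
exact: measurable_normc.
Qed.

Let cmeas w : cmeasurable (fun t => 1 - w * e2pi t)%R.
Proof.
rewrite (_ : (fun t => _) = (fun t => 1 + (- w) * e2pi t)%R); last first.
  by apply/funext => t; rewrite mulNr.
apply: cmeasurableD; first exact: cmeasurable_cst.
by apply: cmeasurableM; [exact: cmeasurable_cst|exact: cmeasurable_e2pi].
Qed.

(** On the closed unit disc |1 - w e(t)| <= 2, so [L] is nonnegative. Jensen's formula there says
    that the mean [M] equals ln 2. *)
Let L w t := (ln 2 - lnc (1 - w * e2pi t))%R.
Let M w := \int[mu]_(t in `[0%R, 1%R[) (L w t)%:E.

Let mL w (D : set R) : measurable_fun D (fun t => (L w t)%:E).
Proof. exact: measurable_lnc. Qed.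

Let normc_1B w t : (Normc.normc w <= 1)%R ->
  (1 - Normc.normc w <= Normc.normc (1 - w * e2pi t) <= 2)%R.
Proof.
move=> w1; apply/andP; split.
  have := normcD (1 - w * e2pi t)%R (w * e2pi t)%R.
  by rewrite subrK Normc.normc1 Normc.normcM normc_e2pi mulr1 lerBlDr.
apply: (le_trans (normcD _ _)).
by rewrite Normc.normc1 normcN Normc.normcM normc_e2pi mulr1 -[leRHS]/(1 + 1)%R lerD2l.
Qed.

Let L_ge0 w t : (Normc.normc w <= 1)%R -> (0 <= L w t)%R.
Proof.
move=> w1; rewrite subr_ge0; have /andP[_ h2] := normc_1B t w1.
by apply: ge0_le_ln => //; [exact: normc_ge0|rewrite ler1n].
Qed.

(** With z = e(t) this is 1 - w^2 z^2 = (1 - w z) (1 + w z), where -z = e(t + 1/2). The logarithm is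
    additive only away from zeros, because [ln 0 = 0]. *)
Let LE w t : (Normc.normc w <= 1)%R -> (1 - (w ^+ 2) * e2pi (2 * t) != 0)%R ->
  (L (w ^+ 2) (2 * t) + ln 2 = L w t + L w (t + 2^-1))%R.
Proof.
move=> w1; rewrite (_ : 1 - _ = (1 - w * e2pi t) * (1 - w * e2pi (t + 2^-1)))%R; last first.
  rewrite e2piD e2pi_half (_ : 2 * t = t + t)%R ?e2piD; ring.
rewrite mulf_eq0 negb_or => /andP[n1 n2]; rewrite /L.
rewrite (_ : 1 - w ^+ 2 * _ = (1 - w * e2pi t) * (1 - w * e2pi (t + 2^-1)))%R; last first.
  rewrite e2piD e2pi_half (_ : 2 * t = t + t)%R ?e2piD; ring.
rewrite Normc.normcM lnM_neq0 ?normc_ge0 ?normc_eq0//; ring.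
Qed.

(** Integrate [LE] over [0, 1/2[: there 2 t runs through a full period, while t and t + 1/2 together
    cover [0, 1[. *)
Let M_double w : (Normc.normc w <= 1)%R -> M (w ^+ 2)%R + (ln 2)%:E = 2%:E * M w.
Proof.
move=> w1; have w21 : (Normc.normc (w ^+ 2) <= 1)%R.
  by rewrite normcX expr_le1// normc_ge0.
have half1 : ((2^-1 : R) <= 1)%R by rewrite invf_le1// ler1n.
have pre01 : ((fun x : R => (2 * x + 0)%R) @^-1` `[0%R, 1%R[) = `[0%R, (2^-1)%R[.
  apply/seteqP; split => x /=; rewrite !in_itv/= addr0 => /andP[x0 x1]; apply/andP; split; lra.
have pre12 : ((fun x : R => (1 * x + 2^-1)%R) @^-1` `[(2^-1)%R, 1%R[) = `[0%R, (2^-1)%R[.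
  apply/seteqP; split => x /=; rewrite !in_itv/= mul1r => /andP[x0 x1]; apply/andP; split; lra.
rewrite /M (@ge0_integral_affine _ 2 0 _ `[0%R, 1%R[)//; last first.
  by move=> x _; rewrite lee_fin L_ge0.
rewrite pre01.
have -> : (ln 2)%:E = 2%:E * \int[mu]_(t in `[0%R, (2^-1)%R[) (ln (2 : R))%:E.
  rewrite integral_itv_cst ?invr_ge0 ?ler0n//.
  by rewrite -!EFinM subr0; congr EFin; field.
have ln20 : (0 <= ln (2 : R))%R by rewrite ln_ge0// ler1n.
have mL2 (D : set R) : measurable D -> measurable_fun D (fun x : R => (L (w ^+ 2) (2 * x + 0))%:E).
  move=> mD; apply: measurable_lnc.
  rewrite (_ : (fun x => _) = (fun t => 1 + (- w ^+ 2) * e2pi (2 * t + 0))%R); last first.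
    by apply/funext => t; rewrite mulNr.
  apply: cmeasurableD; first exact: cmeasurable_cst.
  apply: cmeasurableM; first exact: cmeasurable_cst.
  by apply: cmeasurable_e2pi; apply: measurable_funD => //; exact: measurable_funM.
have mL1 (D : set R) : measurable D -> measurable_fun D (fun x : R => (L w (1 * x + 2^-1))%:E).
  move=> mD; apply: measurable_lnc.
  rewrite (_ : (fun x => _) = (fun t => 1 + (- w) * e2pi (1 * t + 2^-1))%R); last first.
    by apply/funext => t; rewrite mulNr.
  apply: cmeasurableD; first exact: cmeasurable_cst.
  apply: cmeasurableM; first exact: cmeasurable_cst.
  by apply: cmeasurable_e2pi; apply: measurable_funD => //; exact: measurable_funM.
rewrite -muleDr//; last first.
  by apply: ge0_adde_def; rewrite inE integral_ge0// => x _; rewrite lee_fin// L_ge0.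
congr (_ * _); rewrite -ge0_integralD; [|by []| |exact: mL2| |exact: measurable_cst]; last 2 first.
- by move=> x _; rewrite lee_fin L_ge0.
- by move=> x _; rewrite lee_fin.
have -> : `[0%R, 1%R[%classic = `[0%R, (2^-1)%R[ `|` `[(2^-1)%R, 1%R[ :> set R.
  by apply: itv_bndbnd_setU; rewrite bnd_simp.
rewrite ge0_integral_setU//=; last 3 first.
- exact: mL.
- by move=> x _; rewrite lee_fin L_ge0.
- rewrite disj_set2E; apply/eqP; rewrite -subset0 => x []/=; rewrite !in_itv/=.
  by move=> /andP[_ x1] /andP[x2 _]; move: x1; rewrite ltNge x2.
rewrite (@ge0_integral_affine _ 1 2^-1 ltr01 `[(2^-1)%R, 1%R[)//; last first.
  by move=> x _; rewrite lee_fin L_ge0.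
rewrite mul1e pre12 -ge0_integralD; [|by []| |exact: mL| |exact: mL1]; last 2 first.
- by move=> x _; rewrite lee_fin L_ge0.
- by move=> x _; rewrite lee_fin L_ge0.
apply: ge0_ae_eq_integral => //.
- by apply: emeasurable_funD => //; exact: mL2.
- by apply: emeasurable_funD; [exact: mL|exact: mL1].
- by move=> x _; rewrite -EFinD lee_fin addr_ge0// L_ge0.
- by move=> x _; rewrite -EFinD lee_fin addr_ge0// L_ge0.
(* [LE] fails only at zeros of 1 - w e(t) or 1 + w e(t), which form a null set. *)
have nn c : mu.-negligible [set t | `[0%R, 1%R[ t /\ (1 + c * e2pi t = 0)%R].
  by apply: negligible_zeros; rewrite oner_eq0.
apply: (negligibleS _ (negligibleU (nn w) (nn (- w)%R))) => t /= /not_implyP[tI tE].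
have : (1 - (w ^+ 2) * e2pi (2 * t) = 0)%R.
  apply/eqP/negP => /negP n0; apply: tE; rewrite -!EFinD; congr EFin.
  by rewrite addr0 mul1r LE.
rewrite (_ : 2 * t = t + t)%R; last ring.
rewrite e2piD (_ : 1 - _ = (1 + w * e2pi t) * (1 + (- w) * e2pi t))%R; last ring.
have t01 : `[0%R, 1%R[%classic t.
  by move: tI; rewrite /= !in_itv/= => /andP[-> /lt_le_trans]; apply.
by move/eqP; rewrite mulf_eq0 => /orP[] /eqP ?; [left|right].
Qed.

(* By [M_double], [M w - ln 2] doubles when [w] is squared, so a bound along the
   iterated squares forces it to vanish. *)
Let M_cst (C : R) w : (Normc.normc w <= 1)%R ->
  (forall n, M (w ^+ (2 ^ n))%R <= C%:E) -> M w = (ln 2)%:E.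
Proof.
move=> w1 MC; have wn n : (Normc.normc (w ^+ n) <= 1)%R.
  by rewrite normcX exprn_ile1// normc_ge0.
have M0 n : 0 <= M (w ^+ n)%R by apply: integral_ge0 => t _; rewrite lee_fin L_ge0.
have Mf n : M (w ^+ (2 ^ n))%R \is a fin_num.
  by rewrite ge0_fin_numE// (le_lt_trans (MC n))// ltry.
pose d n := (fine (M (w ^+ (2 ^ n))%R) - ln 2)%R.
have dE n : (d n.+1 = 2 * d n)%R.
  have /(congr1 fine) := M_double (wn (2 ^ n)%N).
  by rewrite -exprM -expnSr fineD// fineM//= /d => E; lra.
have dn n : (d n = 2 ^+ n * d 0%N)%R.
  by elim: n => [|n IH]; rewrite ?expr0 ?mul1r// dE IH exprS mulrA.
have db n : (`|d n| <= C + ln 2)%R.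
  have : (0 <= fine (M (w ^+ (2 ^ n))%R) <= C)%R.
    rewrite fine_ge0//= -lee_fin fineK//.
  move=> /andP[m0 mC]; have ln20 : (0 <= ln (2 : R))%R by rewrite ln_ge0// ler1n.
  rewrite ler_norml; apply/andP; split; rewrite /d; lra.
have d0 : d 0%N = 0%R.
  (* As 2^n > n, this [n] makes |d n| = 2^n |d 0| exceed the bound C + ln 2. *)
  apply/eqP/negP => /negP d0; pose n := Num.bound ((C + ln 2) / `|d 0%N|).
  have d00 : (0 < `|d 0%N|)%R by rewrite normr_gt0.
  have : ((C + ln 2) / `|d 0%N| < n%:R)%R.
    apply: archi_boundP; rewrite divr_ge0//.
    by rewrite (le_trans _ (db 0%N)).
  rewrite ltr_pdivrMr// => h; have := db n; rewrite dn normrM ger0_norm ?exprn_ge0//.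
  apply/negP; rewrite -ltNge (lt_le_trans h)// ler_pM2r// -natrX ler_nat ltnW//.
  exact: ltn_expl.
by move/eqP: d0; rewrite /d expn0 expr1 subr_eq0 => /eqP <-; rewrite fineK// -[w]expr1 (Mf 0%N).
Qed.

(** Inside the disc all iterated squares have modulus at most |w|, so |1 - w^(2^n) e(t)| >= 1 - |w|
    bounds the integrands uniformly. *)
Let M_lt1 w : (Normc.normc w < 1)%R -> M w = (ln 2)%:E.
Proof.
move=> w1; apply: (@M_cst (ln 2 - ln (1 - Normc.normc w)) w (ltW w1)) => n.
have wn : (Normc.normc (w ^+ (2 ^ n)) <= Normc.normc w)%R.
  rewrite normcX -[leRHS]expr1 ler_wiXn2l ?expn_gt0// ?normc_ge0//; exact: ltW.
have wn1 := le_trans wn (ltW w1).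
rewrite -[X in X%:E]mulr1 -[X in (_ * X)%R]subr0 -(@integral_itv_cst _ true true) ?ler01//.
apply: ge0_le_integral => //.
- by move=> t _; rewrite lee_fin L_ge0.
- exact: mL.
move=> t _; rewrite lee_fin lerD2l lerN2 ler_ln ?posrE ?subr_gt0//.
  have /andP[+ _] := normc_1B t wn1.
  by apply: le_trans; rewrite lerD2l lerN2.
have /andP[+ _] := normc_1B t wn1.
by apply: lt_le_trans; rewrite subr_gt0 (le_lt_trans wn).
Qed.

(** Expresses the modulus along a radius by its boundary value. This yields the limit r --> 1 when z
    <> 1 and an explicit bound when z = 1. *)
Let normc_1Br (r : R) z : Normc.normc z = 1%R ->
  ((Normc.normc (1 - (r%:C)%C * z)) ^+ 2 = (1 - r) ^+ 2 + r * Normc.normc (1 - z) ^+ 2)%R.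
Proof.
case: z => x y /= z1; have {z1} : (x ^+ 2 + y ^+ 2 = 1)%R.
  by rewrite -[LHS]sqr_sqrtr ?addr_ge0 ?sqr_ge0// z1 expr1n.
move=> xy; rewrite !sqr_sqrtr ?addr_ge0 ?sqr_ge0//.
have : (y ^+ 2 = 1 - x ^+ 2)%R by rewrite -xy addrC addKr.
move=> y2.
transitivity ((1 - r * x) ^+ 2 + r ^+ 2 * y ^+ 2)%R; first ring.
transitivity ((1 - r) ^+ 2 + r * ((1 - x) ^+ 2 + y ^+ 2))%R; last ring.
by rewrite y2; ring.
Qed.

(* On the unit circle the bound of [M_cst] comes from Fatou's lemma along
   [r k * w] with [r k --> 1^-]. *)
Let M_le1 w : (Normc.normc w <= 1)%R -> M w = (ln 2)%:E.
Proof.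
rewrite le_eqVlt => /predU1P[w1|]; last exact: M_lt1.
apply: (@M_cst (ln 2)) => [|n]; first by rewrite w1.
have {w1} : Normc.normc (w ^+ (2 ^ n))%R = 1%R by rewrite normcX w1 expr1n.
move: (w ^+ _)%R => {}w w1.
pose r k : R := (1 - k.+2%:R^-1)%R.
have r01 k : (0 <= r k < 1)%R.
  by rewrite subr_ge0 invf_le1// ler1n/= ltrBlDr ltrDl invr_gt0.
have rw1 k : (Normc.normc ((r k)%:C%C * w) < 1)%R.
  by rewrite Normc.normcM w1 mulr1 normc_real; have /andP[] := r01 k.
(* The interior means are all equal to ln 2, so the bound required by [M_cst] is exactly the lower
   limit in Fatou's lemma. *)
have -> : (ln 2)%:E = limn_einf (fun k => M ((r k)%:C%C * w)%R).
  under eq_fun do rewrite M_lt1//.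
  by apply/esym/(cvg_limn_einf_sup _).1; exact: cvg_cst.
apply: (le_trans _ (@fatou _ _ _ mu `[0%R, 1%R[ _ (fun k t => (L ((r k)%:C%C * w)%R t)%:E) _ _)) => //; last 2 first.
- by move=> k; exact: mL.
- by move=> k t _; rewrite lee_fin L_ge0// ltW.
apply: ge0_le_integral => //.
- by move=> t _; rewrite lee_fin L_ge0// w1.
- exact: mL.
- rewrite (_ : (fun t => _) = (fun t =>
      - limn_esup (fun k => - (L ((r k)%:C%C * w)%R t)%:E))); last first.
    apply/funext => t; rewrite -limn_einfN; congr limn_einf.
    by apply/funext => k; rewrite /= opprK.
  apply: measurableT_comp => //; apply: measurable_fun_limn_esup => k.
  by apply: measurableT_comp => //; exact: mL.
move=> t _; have zt1 : Normc.normc (w * e2pi t)%R = 1%R by rewrite Normc.normcM w1 normc_e2pi mulr1.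
(* At a zero the convention [ln 0 = 0] gives [L w t] the value ln 2 rather than +oo; the pointwise
   inequality survives because |1 - r k| <= 1. *)
have [z0|z0] := eqVneq (1 - w * e2pi t)%R 0%R.
  apply: ge_limn_einf => k; rewrite lee_fin /L z0 Normc.normc0 (ln0 (lexx 0%R)) subr0 lerBrDr gerDl.
  rewrite ln_le0// -(@ler_pXn2r _ 2)// ?nnegrE ?normc_ge0//.
  rewrite -mulrA normc_1Br// z0 Normc.normc0 expr0n/= mulr0 addr0 expr1n expr_le1//.
    by have /andP[] := r01 k; lra.
  by have /andP[] := r01 k; lra.
pose A : R := (Normc.normc (1 - w * e2pi t) ^+ 2)%R.
have A0 : (0 < A)%R by rewrite exprn_gt0// lt0r normc_eq0 z0 normc_ge0.
have lnE z : z != 0%R -> (lnc z = 2^-1 * ln (Normc.normc z ^+ 2))%R.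
  move=> zn0; rewrite lnXn ?lt0r ?normc_eq0 ?zn0 ?normc_ge0//.
  by field.
suff cL : ((L ((r k)%:C%C * w)%R t)%:E) @[k --> \oo] --> (L w t)%:E.
  by rewrite (cvg_limn_einf_sup cL).1.
apply: cvg_EFin; first exact: nearW.
rewrite (_ : fine \o _ = fun k => ln 2 - 2^-1 * ln ((1 - r k) ^+ 2 + r k * A))%R; last first.
  apply/funext => k /=; rewrite /L -mulrA lnE ?normc_1Br// -normc_eq0 -sqrf_eq0 normc_1Br//.
  rewrite gt_eqF// ltr_pwDl ?exprn_gt0 ?subr_gt0 ?mulr_ge0//; try by have /andP[] := r01 k.
    exact: normc_ge0.
  exact: normc_ge0.
rewrite /L lnE// -/A.
have rc : r k @[k --> \oo] --> (1 - 0 : R)%R.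
  apply: cvgB; first exact: cvg_cst.
  by have := @cvg_harmonic R; rewrite -cvg_shiftS.
rewrite subr0 in rc.
have : ((1 - r k) ^+ 2 + r k * A)%R @[k --> \oo] --> ((1 - 1) ^+ 2 + 1 * A)%R.
  apply: cvgD; last by apply: cvgM => //; exact: cvg_cst.
  by under eq_fun do rewrite expr2; rewrite expr2; apply: cvgM; apply: cvgB => //; exact: cvg_cst.
rewrite subrr expr0n/= add0r mul1r => cA.
apply: cvgB; first exact: cvg_cst.
apply: cvgM; first exact: cvg_cst.
by apply: (cvg_comp _ _ cA); exact: continuous_ln.
Qed.

Lemma integral_ln_onePe2pi w (k : R) : (Normc.normc w <= 1)%R -> (ln 2 <= k)%R ->
  \int[mu]_(t in `[0%R, 1%R[) (k - lnc (1 + w * e2pi t))%:E = k%:E.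
Proof.
move=> w1 k2; have w1' : (Normc.normc (- w) <= 1)%R by rewrite normcN.
transitivity (\int[mu]_(t in `[0%R, 1%R[) ((k - ln 2)%:E + (L (- w)%R t)%:E)).
  by apply: eq_integral => t _; rewrite -EFinD /L mulNr opprK; congr EFin; ring.
rewrite ge0_integralD; [|by []| | | |exact: mL]; last 3 first.
- by move=> t _; rewrite lee_fin subr_ge0.
- exact: measurable_cst.
- by move=> t _; rewrite lee_fin L_ge0.
by rewrite integral_itv_cst ?ler01// subr0 mulr1 -/(M _) M_le1// -EFinD subrK.
Qed.

(** The first hypothesis makes the integrand nonnegative away from zeros, and 0 <= k does so at a
    zero. After division by the larger coefficient the formula is the one for 1 + w e(t) with |w| <=
    1. *)
Lemma jensen_linear a b (k : R) : (Normc.normc a + Normc.normc b <= expR k)%R ->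
  (0 <= k)%R ->
  \int[mu]_(t in `[0%R, 1%R[) (k - lnc (a + b * e2pi t))%:E =
  (k - ln (Num.max (Normc.normc a) (Normc.normc b)))%:E.
Proof.
wlog ba : a b / (Normc.normc b <= Normc.normc a)%R.
  move=> H abk k0; have [ba|ab] := orP (le_total (Normc.normc b) (Normc.normc a)).
    exact: H.
  (* Reciprocal polynomial: multiplying by e(-t) and conjugating turns a + b e(t) into conj b + conj
     a e(t) without changing the modulus. *)
  rewrite maxC -(normc_conj a) -(normc_conj b) -H ?normc_conj//; last by rewrite addrC.
  apply: eq_integral => t _; congr (_ - ln _)%:E.
  rewrite -[LHS]mulr1 -(normc_e2pi (- t)) -Normc.normcM -[LHS]normc_conj; congr Normc.normc.
  rewrite mulrDl -mulrA -e2piD subrr e2pi0 mulr1 addrC.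
  by rewrite conjcD conjcM -(e2piN (- t)) opprK.
move=> abk k0; have [a0|a0] := eqVneq a 0%R.
  have b0 : b = 0%R.
    by apply: Normc.eq0_normc; apply/eqP; rewrite eq_le normc_ge0 andbT -(@Normc.normc0 R) -a0.
  rewrite a0 b0 Normc.normc0 maxxx.
  under eq_integral do rewrite mul0r addr0 Normc.normc0.
  by rewrite integral_itv_cst ?ler01// subr0 mulr1.
have na0 : (0 < Normc.normc a)%R by rewrite lt0r normc_eq0 a0 normc_ge0.
rewrite max_l//.
have b1 : (Normc.normc (b / a) <= 1)%R.
  by rewrite Normc.normcM Normc.normcV ler_pdivrMr// mul1r.
(* After factoring out [a] the natural constant is k - ln |a|, which may lie below ln 2. Raising it
   to [m] and adding the difference to both sides keeps all integrands nonnegative. *)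
pose m : R := Num.max (ln 2) (k - lnc a)%R.
have m2 : (ln 2 <= m)%R by rewrite le_max lexx.
have mka : (k - lnc a <= m)%R by rewrite le_max lexx orbT.
have g0 t : (0 <= m - lnc (1 + (b / a) * e2pi t))%R.
  rewrite subr_ge0 (le_trans _ m2)// ge0_le_ln ?ler1n ?normc_ge0//.
  rewrite (le_trans (normcD _ _))// Normc.normc1 Normc.normcM normc_e2pi mulr1.
  by rewrite -[leRHS]/(1 + 1)%R lerD2l.
have f0 t : (0 <= k - lnc (a + b * e2pi t))%R.
  rewrite subr_ge0 -[leRHS]expRK ge0_le_ln ?normc_ge0//.
    by rewrite (le_trans (normcD _ _))// Normc.normcM normc_e2pi mulr1.
  by rewrite -expR0 ler_expR.
have cm c d : cmeasurable (fun t => c + d * e2pi t)%R.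
  apply: cmeasurableD; first exact: cmeasurable_cst.
  by apply: cmeasurableM; [exact: cmeasurable_cst|exact: cmeasurable_e2pi].
suff : \int[mu]_(t in `[0%R, 1%R[) (k - lnc (a + b * e2pi t))%:E + (m - (k - lnc a))%:E = m%:E.
  move/(congr1 (fun x => x - (m - (k - lnc a))%:E)); rewrite addeK// => ->.
  by rewrite -EFinB; congr EFin; ring.
have -> : (m - (k - lnc a))%:E = \int[mu]_(t in `[0%R, 1%R[) (m - (k - lnc a))%:E.
  by rewrite integral_itv_cst ?ler01// subr0 mulr1.
rewrite -ge0_integralD; last 5 first.
- by [].
- by move=> t _; rewrite lee_fin.
- by apply: measurable_lnc; exact: cm.
- by move=> t _; rewrite lee_fin subr_ge0.
- exact: measurable_cst.
rewrite -(@integral_ln_onePe2pi (b / a)%R m b1 m2).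
apply: ge0_ae_eq_integral => //.
- by apply: emeasurable_funD; [apply: measurable_lnc; exact: cm|exact: measurable_cst].
- by apply: measurable_lnc; exact: cm.
- by move=> t _; rewrite -EFinD lee_fin addr_ge0// subr_ge0.
- by move=> t _; rewrite lee_fin.
have nn : mu.-negligible [set t | `[0%R, 1%R[ t /\ (a + b * e2pi t = 0)%R].
  by apply: negligible_zeros; rewrite a0.
apply: (negligibleS _ nn) => t /= /not_implyP[tI tE]; split => //.
apply/eqP/negP => /negP n0; apply: tE; rewrite -EFinD; congr EFin.
have E : (a + b * e2pi t = a * (1 + b / a * e2pi t))%R by field.
have n1 : (1 + b / a * e2pi t != 0)%R by apply: contraNneq n0 => z0; rewrite E z0 mulr0.
by rewrite E Normc.normcM lnM_neq0 ?normc_ge0 ?normc_eq0//; ring.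
Qed.

End jensen.

(** * Reduction of the Mahler measure to a double integral *)

Section mahler_reduction.
Context {R : realType}.
Notation mu := (@lebesgue_measure R).
Notation lnc z := (ln (Normc.normc z)).
Local Open Scope ereal_scope.

(** The way back from nonnegative integrands: a finite integral of k - g over a set of measure 1
    makes the difference k - (k - g) legitimate, though [g] may be unbounded below. *)
Lemma integral_of_ge0_compl d (T : measurableType d) (m : {measure set T -> \bar R})
    (D : set T) (g : T -> R) (k v : R) : measurable D -> m D = 1 ->
  measurable_fun D g -> (forall x, D x -> (g x <= k)%R) ->
  \int[m]_(x in D) (k - g x)%:E = v%:E -> \int[m]_(x in D) (g x)%:E = (k - v)%:E.
Proof.
move=> mD mD1 mg gk kv.
have ik : m.-integrable D (EFin \o cst k).
  apply/integrableP; split; first by apply/measurable_EFinP; exact: measurable_cst.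
  have := @integral_cst _ _ _ m _ mD `|k%:E|; rewrite /cst/= => ->.
  by rewrite mD1 mule1 ltry.
have ikg : m.-integrable D (EFin \o (fun x => k - g x)%R).
  apply/integrableP; split; first by apply/measurable_EFinP; apply: measurable_funB.
  rewrite (eq_integral (fun x => (k - g x)%:E)) ?kv ?ltry// => x; rewrite inE => Dx /=.
  by rewrite ger0_norm// subr_ge0 gk.
transitivity (\int[m]_(x in D) ((cst k x)%:E - (k - g x)%:E)).
  by apply: eq_integral => x _; rewrite -EFinB /= subKr.
have := @integralB_EFin _ _ _ m _ _ _ mD ik ikg; rewrite /= => ->.
rewrite kv; have := @integral_cst _ _ _ m _ mD k%:E; rewrite /cst/= => ->.
by rewrite mD1 mule1.
Qed.

(* A named copy of [mu \x mu], so that it can carry a sigma-finite structure. *)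
Definition lebesgue_measure2 : set (measurableTypeR R * measurableTypeR R)%type -> \bar R :=
  mu \x mu.

HB.instance Definition _ := Measure.on lebesgue_measure2.

Let sigma_finite_lebesgue_measure2 : sigma_finite setT lebesgue_measure2.
Proof.
exists (fun n => `[(- n%:R)%R, n%:R%R] `*` `[(- n%:R)%R, n%:R%R]).
  apply/esym; rewrite -subTset => -[x y] _ /=.
  exists (Num.bound (`|x| + `|y|)%R) => //=.
  have := @archi_boundP _ (`|x| + `|y|)%R; rewrite addr_ge0// => /(_ isT).
  set n := Num.Def.archi_bound _ => nP; rewrite !in_itv/= -!ler_norml; split.
    by rewrite (le_trans _ (ltW nP))// lerDl.
  by rewrite (le_trans _ (ltW nP))// lerDr.
move=> n; split; first exact: measurableX.
rewrite [X in X < _]product_measure1E//= lebesgue_measure_itv/=.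
by case: ifPn => _; rewrite ?mul0e ?ltry// -EFinD -EFinM ltry.
Qed.

HB.instance Definition _ := Measure_isSigmaFinite.Build _ _ _ lebesgue_measure2
  sigma_finite_lebesgue_measure2.

Let le6 (x : R) : (x <= 6 -> x <= expR 6)%R.
Proof. by move=> x6; rewrite (le_trans _ (expR_ge1Dx _))//; lra. Qed.

Lemma jensen_linear01 (a b : R[i]) : (Normc.normc a + Normc.normc b <= 6)%R ->
  \int[mu]_(t in `[0%R, 1%R]) (6 - lnc (a + b * e2pi t))%:E =
  (6 - ln (Num.max (Normc.normc a) (Normc.normc b)))%:E.
Proof.
move=> ab6; rewrite -jensen_linear ?le6// -integral_itv_bndo_bndc//.
apply: measurable_lnc; apply: cmeasurableD; first exact: cmeasurable_cst.
by apply: cmeasurableM; [exact: cmeasurable_cst|exact: cmeasurable_e2pi].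
Qed.

Let P (t : R * R * R) : R[i] := ((1 + e2pi t.1.1) ^+ 2 + e2pi t.1.2 + e2pi t.2)%R.

Let cmP : cmeasurable P.
Proof.
apply: cmeasurableD.
  apply: cmeasurableD.
    rewrite (_ : (fun t => _) = (fun t : R * R * R => (1 + e2pi t.1.1) * (1 + e2pi t.1.1)))%R.
      apply: cmeasurableM; apply: cmeasurableD; try exact: cmeasurable_cst;
      by apply: cmeasurable_e2pi; exact: measurableT_comp.
    by apply/funext => t; rewrite expr2.
  by apply: cmeasurable_e2pi; exact: measurableT_comp.
exact: cmeasurable_e2pi.
Qed.

Let nc1 t : (Normc.normc (1 + e2pi t : R[i]) <= 2)%R.
Proof. by rewrite (le_trans (normcD _ _))// Normc.normc1 normc_e2pi -[leRHS]/(1 + 1)%R. Qed.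

Let nc2 t : (Normc.normc ((1 + e2pi t) ^+ 2 : R[i])%R <= 4)%R.
Proof.
rewrite normcX (_ : 4 = 2 ^+ 2)%R; last ring.
by rewrite lerXn2r// ?nnegrE ?normc_ge0.
Qed.

Let ln6 (z : R[i]) : (Normc.normc z <= 6)%R -> (lnc z <= 6)%R.
Proof. by move=> z6; rewrite (le_trans (ge0_ln_le _))// normc_ge0. Qed.

Let P6 t : (Normc.normc (P t) <= 6)%R.
Proof.
rewrite (le_trans (normcD _ _))// (le_trans (lerD (normcD _ _) (lexx _)))//.
by rewrite !normc_e2pi; have := nc2 t.1.1; lra.
Qed.

(** In effect x3 is replaced by x2 x3, which makes the polynomial c + (1 + x3) x2, linear in x2 with
    a coefficient free of c. Two uses of Jensen's formula stand in for this rotation of the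
    circle. *)
Lemma integral_circle2 (c : R[i]) : (Normc.normc c <= 4)%R ->
  \int[mu]_(t2 in `[0%R, 1%R]) \int[mu]_(t3 in `[0%R, 1%R])
    (6 - lnc (c + e2pi t2 + e2pi t3))%:E =
  \int[mu]_(t3 in `[0%R, 1%R])
    (6 - ln (Num.max (Normc.normc c) (Normc.normc (1 + e2pi t3))))%:E.
Proof.
move=> c4.
have ce t : (Normc.normc (c + e2pi t) <= 5)%R.
  by rewrite (le_trans (normcD _ _))// normc_e2pi; lra.
transitivity (\int[mu]_(t2 in `[0%R, 1%R]) \int[mu]_(t3 in `[0%R, 1%R])
    (6 - lnc (c + (1 + e2pi t3) * e2pi t2))%:E).
  apply: eq_integral => t2 _.
  transitivity (\int[mu]_(t3 in `[0%R, 1%R]) (6 - lnc ((c + e2pi t2) + 1 * e2pi t3))%:E).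
    by apply: eq_integral => t3 _; rewrite mul1r.
  rewrite jensen_linear01; last by rewrite Normc.normc1; have := ce t2; lra.
  (* Jensen's formula has produced max(|c + e(t2)|, 1). Reading 1 as |e(t2)|, it is also the value
     for (c + e(t2)) + e(t2) e(t3). *)
  rewrite Normc.normc1 -{2}(normc_e2pi t2) -jensen_linear01; last first.
    by rewrite normc_e2pi; have := ce t2; lra.
  by apply: eq_integral => t3 _; congr (6 - lnc _)%:E; ring.
rewrite (@ge0_integral_prod_swap _ _ _ _ R mu mu `[0%R, 1%R] `[0%R, 1%R]
  (fun z => (6 - lnc (c + (1 + e2pi z.2) * e2pi z.1))%:E))//=.
- apply: eq_integral => t3 _; rewrite jensen_linear01//.
  by have := nc1 t3; lra.
- apply: measurable_lnc; apply: cmeasurableD; first exact: cmeasurable_cst.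
  apply: cmeasurableM; last exact: cmeasurable_e2pi.
  by apply: cmeasurableD; [exact: cmeasurable_cst|exact: cmeasurable_e2pi].
- move=> [t2 t3]; rewrite lee_fin subr_ge0 ln6//= (le_trans (normcD _ _))//.
  by rewrite Normc.normcM normc_e2pi; have := nc1 t3; lra.
Qed.

Lemma mahler3_of_integral (v : R) :
  \int[mu]_(t3 in `[0%R, 1%R]) \int[mu]_(t1 in `[0%R, 1%R])
    (6 - ln (Num.max (Normc.normc (1 + e2pi t1) ^+ 2) (Normc.normc (1 + e2pi t3))))%:E
    = v%:E ->
  mahler3 (fun x1 x2 x3 : R[i] => ((1 + x1) ^+ 2 + x2 + x3)%R) = (6 - v)%:E.
Proof.
move=> vE; rewrite /mahler3.
have box1 : (mu \x mu \x mu)%E ((`[0%R, 1%R] `*` `[0%R, 1%R]) `*` `[0%R, 1%R]) = 1.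
  rewrite product_measure1E//; last exact: measurableX.
  rewrite [X in X * _]product_measure1E//= lebesgue_measure_itv/= lte_fin ltr01.
  by rewrite oppr0 adde0 !mule1.
refine (@integral_of_ge0_compl _ _ ((mu \x mu) \x mu)
  ((`[0%R, 1%R] `*` `[0%R, 1%R]) `*` `[0%R, 1%R]) (fun t => lnc (P t)) 6 v _ box1 _ _ _).
- by apply: measurableX => //; exact: measurableX.
- by apply/measurable_funTS; apply: measurableT_comp => //; exact: measurable_normc.
- by move=> t _; exact: ln6.
have mP : measurable_fun setT (fun t => (6 - lnc (P t))%:E) by exact: measurable_lnc.
have P0 t : 0 <= (6 - lnc (P t))%:E by rewrite lee_fin subr_ge0 ln6.
have mII : measurable (`[0%R, 1%R] `*` `[0%R, 1%R] : set (measurableTypeR R * measurableTypeR R)).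
  exact: measurableX.
(* [lebesgue_measure2] agrees with [mu \x mu] by unfolding, hence [refine] with explicit arguments
   in place of [rewrite]. *)
refine (etrans (@ge0_integral_prod1 _ _ (measurableTypeR R * measurableTypeR R)%type _ R lebesgue_measure2 mu
  (`[0%R, 1%R] `*` `[0%R, 1%R]) `[0%R, 1%R]
  (fun t => (6 - lnc (P t))%:E) mII (measurable_itv _) mP P0) _).
refine (etrans (@ge0_integral_prod1 _ _ _ _ R mu mu `[0%R, 1%R] `[0%R, 1%R]
  (fun x => \int[mu]_(y in `[0%R, 1%R]) (6 - lnc (P (x, y)))%:E)
  (measurable_itv _) (measurable_itv _) _ _) _).
- exact: (@ge0_integral_prod_measurable _ _ _ _ R mu `[0%R, 1%R] _ (measurable_itv _) mP P0).
- by move=> x; apply: integral_ge0.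
rewrite -vE.
(* The product measure puts t1 outermost, while the later expansion needs t1 innermost, with |1 +
   e(t3)| as a parameter. *)
refine (etrans _ (@ge0_integral_prod_swap _ _ _ _ R mu mu `[0%R, 1%R] `[0%R, 1%R]
    (fun z => (6 - ln (Num.max (Normc.normc (1 + e2pi z.1) ^+ 2) (Normc.normc (1 + e2pi z.2))))%:E)
    (measurable_itv _) (measurable_itv _) _ _)).
- apply: eq_integral => t1 _; refine (etrans (integral_circle2 (nc2 t1)) _).
  by apply: eq_integral => t3 _; rewrite normcX.
- apply/measurable_EFinP; apply: measurable_funB => //; apply: measurableT_comp => //.
  apply: measurable_maxr.
    apply: measurable_funX; apply: measurable_normc; apply: cmeasurableD; first exact: cmeasurable_cst.
    exact: cmeasurable_e2pi.
  apply: measurable_normc; apply: cmeasurableD; first exact: cmeasurable_cst.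
  exact: cmeasurable_e2pi.
- case=> t1 t3; rewrite lee_fin subr_ge0 (le_trans (ge0_ln_le _))//.
    by rewrite le_max normc_ge0 orbT.
  rewrite ge_max -normcX; have := nc1 t3; have := nc2 t1 => h1 h2.
  by apply/andP; split; lra.
Qed.

End mahler_reduction.

(** * The arcsine series *)

Section central_binomial_series.
Context {R : realType}.

(** The Taylor coefficients of (1 - u)^(-1/2), that is binomial(2k, k) / 4^k. *)
Definition bcoef (k : nat) : R := poch 2^-1 k / k`!%:R.

Lemma pochS (a : R) n : poch a n.+1 = poch a n * (a + n%:R).
Proof. by rewrite /poch big_ord_recr. Qed.

Lemma poch0 (a : R) : poch a 0 = 1.
Proof. by rewrite /poch big_ord0. Qed.

Lemma poch_gt0 (a : R) n : 0 < a -> 0 < poch a n.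
Proof. by move=> a0; apply: prodr_gt0 => i _; rewrite ltr_wpDr. Qed.

Lemma bcoef0 : bcoef 0 = 1.
Proof. by rewrite /bcoef poch0 fact0 divr1. Qed.

Lemma bcoefS k : bcoef k.+1 = bcoef k * (2^-1 + k%:R) / k.+1%:R.
Proof.
rewrite /bcoef pochS factS natrM invfM; ring.
Qed.

Lemma bcoefS_mul k : k.+1%:R * bcoef k.+1 = (k%:R + 2^-1) * bcoef k.
Proof. by rewrite bcoefS; field; rewrite nat1r pnatr_eq0. Qed.

Lemma bcoef_gt0 k : 0 < bcoef k.
Proof. by rewrite divr_gt0 ?poch_gt0 ?invr_gt0// ltr0n fact_gt0. Qed.

(* With [s n] the convolution and [t n] the same sum weighted by [i], symmetry
   gives [2 t n = n s n] and the recurrence of [bcoef] gives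
   [t n.+1 = t n + s n / 2]; hence [s n.+1 = s n]. *)
Lemma bcoef_conv n : \sum_(i < n.+1) bcoef i * bcoef (n - i)%N = 1.
Proof.
pose s n := \sum_(i < n.+1) bcoef i * bcoef (n - i)%N.
pose t n := \sum_(i < n.+1) i%:R * (bcoef i * bcoef (n - i)%N).
have ts m : 2 * t m = m%:R * s m.
  have tE : t m = \sum_(i < m.+1) (m - i)%:R * (bcoef i * bcoef (m - i)%N).
    rewrite /t (reindex_inj rev_ord_inj)/=; apply: eq_bigr => i _.
    by rewrite subSS subKn 1?mulrA 1?[bcoef _ * bcoef _]mulrC ?mulrA// -ltnS.
  rewrite mulr_natl mulr2n {1}tE /t -big_split/= /s mulr_sumr; apply: eq_bigr => i _.
  by rewrite -mulrDl -natrD subnK// -ltnS.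
have tS m : t m.+1 = t m + s m / 2.
  rewrite /t big_ord_recl/= mul0r add0r /s mulr_suml -big_split/=; apply: eq_bigr => i _.
  rewrite /bump/= add1n subSS mulrA bcoefS_mul; ring.
have sS m : s m.+1 = s m.
  have E := ts m.+1; rewrite tS mulrDr ts in E.
  have m1 : m.+1%:R != 0 :> R by rewrite pnatr_eq0.
  by apply: (mulfI m1); rewrite -E -natr1; field.
elim: n => [|n IH]; last by rewrite -[LHS]/(s n.+1) sS.
by rewrite big_ord1 subn0 bcoef0 mulr1.
Qed.

Lemma bcoef_conv_le n k : \sum_(j < k.+1) (\poly_(i < n) bcoef i)`_j * (\poly_(i < n) bcoef i)`_(k - j) <= 1.
Proof.
rewrite -(bcoef_conv k); apply: ler_sum => j _; rewrite !coef_poly.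
have b0 i : 0 <= bcoef i by exact/ltW/bcoef_gt0.
by case: ifP => _; case: ifP => _; rewrite ?mul0r ?mulr0// mulr_ge0.
Qed.

Let psum_geo (u : R) n : u != 1 -> \sum_(i < n) u ^+ i = (1 - u ^+ n) / (1 - u).
Proof.
move=> u1; have u10 : 1 - u != 0 by rewrite subr_eq0 eq_sym.
apply: (mulIf u10); rewrite divfK// -opprB mulrN -[X in _ = X]opprB; congr (- _).
by rewrite subrX1 mulrC.
Qed.

(** The squared partial sum is a polynomial whose coefficients are 1 below degree n, by
    [bcoef_conv], and lie in [0, 1] beyond. Geometric sums bound it on both sides. *)
Lemma sqr_bcoef_psum (u : R) n : 0 <= u < 1 ->
  (1 - u ^+ n) / (1 - u) <= (\sum_(0 <= k < n) bcoef k * u ^+ k) ^+ 2 <= (1 - u)^-1.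
Proof.
move=> /andP[u0 u1]; have un1 : u != 1 by rewrite lt_eqF.
have cu : 0 < 1 - u by rewrite subr_gt0.
pose p := \poly_(i < n) bcoef i.
have -> : \sum_(0 <= k < n) bcoef k * u ^+ k = p.[u].
  by rewrite horner_poly big_mkord.
have b0 i : 0 <= bcoef i by exact/ltW/bcoef_gt0.
have szp : (size (p * p)%R <= n + n)%N.
  rewrite (leq_trans (size_polyMleq _ _))// (leq_trans (leq_pred _))//.
  by rewrite leq_add// size_poly.
rewrite expr2 -hornerM (horner_coef_wide _ szp).
have c0 i : 0 <= (p * p)`_i.
  rewrite coefM sumr_ge0// => j _; rewrite !coef_poly.
  by case: ifP => _; case: ifP => _; rewrite ?mul0r ?mulr0// mulr_ge0.
apply/andP; split.
  rewrite big_split_ord/= -psum_geo// -[leLHS]addr0 lerD//; last first.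
    by apply: sumr_ge0 => i _; rewrite mulr_ge0// exprn_ge0.
  apply: ler_sum => i _; rewrite (_ : (p * p)`_i = 1) ?mul1r//.
  rewrite coefM -[RHS](bcoef_conv i); apply: eq_bigr => j _; rewrite !coef_poly.
  have ji : (j <= i)%N by rewrite -ltnS.
  by rewrite (leq_ltn_trans ji)// (leq_ltn_trans (leq_subr _ _)).
apply: (@le_trans _ _ (\sum_(i < n + n) u ^+ i)).
  apply: ler_sum => i _; rewrite -[leRHS]mul1r ler_wpM2r ?exprn_ge0//.
  by rewrite coefM bcoef_conv_le.
rewrite psum_geo// ler_pdivrMr// mulVf ?gt_eqF// gerBl exprn_ge0//.
Qed.

Lemma cvg_bcoef_series (u : R) : 0 <= u < 1 ->
  series (fun k => bcoef k * u ^+ k) @ \oo --> (Num.sqrt (1 - u))^-1.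
Proof.
move=> /[dup] u01 /andP[u0 u1]; have cu : 0 < 1 - u by rewrite subr_gt0.
pose s n := (series (fun k => bcoef k * u ^+ k) n).
have s0 n : 0 <= s n.
  by apply: sumr_ge0 => k _; rewrite mulr_ge0 ?exprn_ge0// ltW// bcoef_gt0.
have sqc : (fun n => s n ^+ 2) @ \oo --> (1 - u)^-1.
  apply: (@squeeze_cvgr _ _ _ _ (fun n => (1 - u ^+ n) / (1 - u)) (fun=> (1 - u)^-1)).
  - by apply: nearW => n; have := sqr_bcoef_psum n u01.
  - suff : (1 - u ^+ n) / (1 - u) @[n --> \oo] --> (1 - 0) / (1 - u) by rewrite subr0 mul1r.
    apply: cvgM; last exact: cvg_cst.
    apply: cvgB; first exact: cvg_cst.
    by apply: cvg_expr; rewrite ger0_norm.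
  - exact: cvg_cst.
have -> : (Num.sqrt (1 - u))^-1 = Num.sqrt (1 - u)^-1 by rewrite sqrtrV ?ltW.
rewrite (_ : series _ = fun n => Num.sqrt (s n ^+ 2)).
  by apply: (cvg_comp _ _ sqc); exact: sqrt_continuous.
by apply/funext => n; rewrite sqrtr_sqr ger0_norm.
Qed.

End central_binomial_series.

Section nneseries_facts.
Context {R : realType}.
Notation mu := (@lebesgue_measure R).
Local Open Scope ereal_scope.

Lemma nneseries_EFin (u : R^nat) (l : R) : series u @ \oo --> l ->
  \sum_(k <oo) (u k)%:E = l%:E.
Proof.
move=> ul; apply/cvg_lim => //.
rewrite (_ : (fun n => _) = EFin \o series u); first by apply: cvg_EFin => //; exact: nearW.
by apply/funext => n; rewrite /= sumEFin.
Qed.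

Lemma integral_itv_exprn (b0 b1 : bool) (c z : R) n : (0 <= z)%R ->
  \int[mu]_(x in [set` Interval (BSide b0 0%R) (BSide b1 z)]) (c * x ^+ n)%:E =
  (c * z ^+ n.+1 / n.+1%:R)%:E.
Proof.
have mf (D : set R) : measurable_fun D (fun x : R => (c * x ^+ n)%:E).
  by apply/measurable_EFinP; apply: measurable_funM => //; exact: measurable_funX.
rewrite le_eqVlt => /predU1P[<-|z0].
  rewrite (@integral_Sset1 _ _ _ 0%R); first by rewrite expr0n/= mulr0 mul0r.
  move=> x; case: b0 b1 => -[] /=; rewrite in_itv/= => /andP[h1 h2] //=; apply/eqP;
  rewrite eq_le; move: h1 h2 => /=; lra.
rewrite integral_itv_bndoo; last exact: mf.
rewrite -(@integral_itv_bndoo _ _ _ _ true false); last exact: mf.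
pose F := (fun x : R => c / n.+1%:R * x ^+ n.+1)%R.
have dF x : is_derive x (1 : R)%R F (c * x ^+ n)%R.
  have -> : (c * x ^+ n = (c / n.+1%:R) *: ((n.+1%:R * x ^+ n) *: 1))%R.
    by rewrite /GRing.scale/= mulr1 mulrA divfK// pnatr_eq0.
  apply: (@is_deriveZ R R R (fun x : R => x ^+ n.+1)%R).
  rewrite (_ : (fun x : R => x ^+ n.+1)%R = (@id R) ^+ n.+1)%R.
    exact: (@is_deriveX R R (@id R) n.+1 x 1%R 1%R).
  by apply/funext => y; rewrite exprfctE.
have cF : continuous F.
  by move=> x; apply/differentiable_continuous/derivable1_diffP; have [] := dF x.
rewrite (@continuous_FTC2 _ _ F)//.
- by rewrite /F expr0n/= mulr0 oppr0 addr0; congr EFin; rewrite mulrAC.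
- apply: continuous_subspaceT => x; apply: cvgM; first exact: cvg_cst.
  exact: exprn_continuous.
- split.
  + by move=> x _; have [] := dF x.
  + by apply: cvg_at_right_filter; exact: cF.
  + by apply: cvg_at_left_filter; exact: cF.
- by move=> x _; rewrite derive1E; have [_ ->] := dF x.
Qed.

(** The derivative (1 - x^2)^(-1/2) is expanded at u = x^2 and integrated term by term over
    [0, z]. *)
Lemma asin_nneseries (z : R) : (0 <= z < 1)%R ->
  (asin z)%:E = \sum_(k <oo) (bcoef k / (2 * k).+1%:R * z ^+ (2 * k).+1)%:E.
Proof.
move=> /andP[]; rewrite le_eqVlt => /predU1P[<- _|z0 z1].
  have -> : asin (0 : R) = 0%R.
    rewrite -{1}(@sin0 R) sinK// in_itv/=; have := @pi_gt0 R => ?; apply/andP; split; lra.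
  by rewrite eseries0// => k _ _; rewrite expr0n/= mulr0.
pose f (x : R) := ((Num.sqrt (1 - x ^+ 2))^-1)%R.
have x1 (x : R) : x \in `[0%R, z]%R -> (0 <= x ^+ 2 < 1)%R.
  rewrite in_itv/= => /andP[x0 xz]; rewrite sqr_ge0/= expr_lt1//; lra.
have dasin (x : R) : x \in `[0%R, z]%R -> is_derive x (1 : R)%R asin (f x).
  by rewrite in_itv/= => /andP[x0 xz]; apply: is_derive1_asin; apply/andP; split; lra.
have casin (x : R) : x \in `[0%R, z]%R -> {for x, continuous asin}.
  by rewrite in_itv/= => /andP[x0 xz]; apply: continuous_asin; apply/andP; split; lra.
have asin0 : asin (0 : R) = 0%R.
  rewrite -{1}(@sin0 R) sinK// in_itv/=; have := @pi_gt0 R => ?; apply/andP; split; lra.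
have mt k (D : set R) : measurable_fun D (fun x : R => (bcoef k * x ^+ (2 * k))%:E).
  by apply/measurable_EFinP; apply: measurable_funM => //; exact: measurable_funX.
have -> : (asin z)%:E = \int[mu]_(x in `[0%R, z]) (f x)%:E.
  rewrite (@continuous_FTC2 _ _ asin)//.
  - by rewrite asin0 sube0.
  - apply: continuous_in_subspaceT => x /[1!inE] xI; apply: cvgV.
      by rewrite sqrtr_eq0 -ltNge subr_gt0; have /andP[] := x1 x xI.
    apply: continuous_comp; last exact: sqrt_continuous.
    apply: cvgB; first exact: cvg_cst.
    exact: exprn_continuous.
  - split.
    + by move=> x xI; have [] := dasin x (subset_itv_oo_cc xI).
    + by apply: cvg_at_right_filter; apply: casin; rewrite in_itv/= lexx ltW.
    + by apply: cvg_at_left_filter; apply: casin; rewrite in_itv/= lexx ltW.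
  - by move=> x xI; rewrite derive1E; have [_ ->] := dasin x (subset_itv_oo_cc xI).
transitivity (\int[mu]_(x in `[0%R, z]) \sum_(k <oo) (bcoef k * x ^+ (2 * k))%:E).
  apply: eq_integral => x /[1!inE] xI; apply/esym/nneseries_EFin.
  rewrite (_ : (fun k => _) = (fun k => bcoef k * (x ^+ 2) ^+ k))%R; last first.
    by apply/funext => k; rewrite exprM.
  by apply: cvg_bcoef_series; exact: x1.
rewrite integral_nneseries//.
- apply: eq_eseriesr => k _; rewrite integral_itv_exprn 1?ltW//; congr EFin.
  by rewrite mulrAC.
- by move=> k; exact: mt.
- move=> k x /=; rewrite in_itv/= => /andP[x0 _].
  by rewrite lee_fin mulr_ge0// ?exprn_ge0// ltW// bcoef_gt0.
Qed.

End nneseries_facts.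

(** * The arcsine law and the integral of ln max(2 |cos (pi t)|, x) *)

Section layer_cake.
Context {R : realType}.
Notation mu := (@lebesgue_measure R).
Local Open Scope ereal_scope.

Lemma integral_itv_derive (b0 b1 : bool) (f F : R -> R) (a b : R) : (a <= b)%R ->
  (forall x, (a <= x <= b)%R -> is_derive x (1 : R)%R F (f x)) ->
  (forall x, (a <= x <= b)%R -> {for x, continuous f}) ->
  \int[mu]_(x in [set` Interval (BSide b0 a) (BSide b1 b)]) (f x)%:E = (F b - F a)%:E.
Proof.
rewrite le_eqVlt => /predU1P[<- _ _|ab dF cf].
  rewrite (@integral_Sset1 _ _ _ a) ?subrr//.
  by move=> x; case: b0 b1 => -[] /=; rewrite in_itv/= => /andP[h1 h2] //=; apply/eqP;
  rewrite eq_le; move: h1 h2 => /=; lra.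
have cfo : {in `]a, b[%R, continuous f}.
  by move=> x; rewrite in_itv/= => /andP[ax xb]; apply: cf; rewrite !ltW.
have mfo : measurable_fun `]a, b[ (EFin \o f).
  apply/measurable_EFinP; apply: open_continuous_measurable_fun => //.
  by move=> x; rewrite inE => xab; exact: cfo.
rewrite integral_itv_bndoo// -(@integral_itv_bndoo _ _ _ _ true false)//.
have cF x : (a <= x <= b)%R -> {for x, continuous F}.
  by move=> xab; apply/differentiable_continuous/derivable1_diffP; have [] := dF x xab.
rewrite (@continuous_FTC2 _ _ F)//.
- apply: continuous_in_subspaceT => x /[1!inE]/=; rewrite in_itv/=; exact: cf.
- split.
  + by move=> x; rewrite in_itv/= => /andP[ax xb]; have [] := dF x; rewrite ?ltW.
  + by apply: cvg_at_right_filter; apply: cF; rewrite lexx ltW.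
  + by apply: cvg_at_left_filter; apply: cF; rewrite lexx ltW.
- by move=> x; rewrite in_itv/= => /andP[ax xb]; rewrite derive1E; have [] := dF x; rewrite ?ltW.
Qed.

(** Since |cos (pi t)| = sin (pi |1/2 - t|) on the period, the sublevel set is the interval centred
    at 1/2 of half-width asin z / pi. *)
Lemma measure_cos_lt (z : R) : (0 <= z <= 1)%R ->
  mu (`[0%R, 1%R[ `&` [set t | `|cos (pi * t)| < z]%R) = (2 / pi * asin z)%:E.
Proof.
move=> /andP[z0 z1]; have pi0 := @pi_gt0 R.
have zN1 : (-1 <= z <= 1)%R by apply/andP; split; lra.
pose a := (asin z / pi)%R.
have apiE : (pi * a = asin z)%R by rewrite /a mulrC divfK// gt_eqF.
have asin_ge0 : (0 <= asin z)%R.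
  have : asin z \in `[- (pi / 2), pi / 2]%R by rewrite in_itv/= asin_geNpi2// asin_lepi2.
  have : (0 : R)%R \in `[- (pi / 2), pi / 2]%R by rewrite in_itv/=; apply/andP; split; lra.
  move=> h0 h1; rewrite leNgt; apply/negP => /(proj2 (rwP idP)); rewrite -(ltr_sin h1 h0).
  by rewrite asinK ?in_itv//= sin0 ltNge z0.
have asin_le := asin_lepi2 zN1.
have a0 : (0 <= a)%R by rewrite divr_ge0// ltW.
have a2 : (a <= 2^-1)%R by rewrite ler_pdivrMr// mulrC.
have cosE t : cos (pi * t) = sin (pi * (2^-1 - t)).
  by rewrite mulrBr -cosBpihalf -cosN; congr cos; ring.
have -> : `[0%R, 1%R[ `&` [set t | `|cos (pi * t)| < z]%R = `](2^-1 - a)%R, (2^-1 + a)%R[.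
  have H t : (`|2^-1 - t| <= 2^-1)%R -> (`|cos (pi * t)| < z)%R = (`|2^-1 - t| < a)%R.
    move=> tb; have -> : (`|cos (pi * t)| = sin (pi * `|2^-1 - t|))%R.
      rewrite cosE; have [h|h] := leP 0%R (2^-1 - t)%R.
        rewrite !ger0_norm//; apply: sin_ge0_pi; rewrite mulr_ge0//= ?(ltW pi0)//.
        by rewrite ger0_norm// in tb; rewrite -[leRHS]mulr1 ler_pM2l//; lra.
      rewrite (ltr0_norm h) mulrN sinN ler0_norm//.
      rewrite -oppr_ge0 -sinN -mulrN; apply: sin_ge0_pi.
      rewrite mulr_ge0//= ?(ltW pi0)//; last lra.
      by rewrite ltr0_norm// in tb; rewrite -[leRHS]mulr1 ler_pM2l//; lra.
    rewrite -{1}(@asinK R z) ?in_itv//= ltr_sin ?in_itv/=.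
    - by rewrite -apiE ltr_pM2l.
    - have : (0 <= pi * `|2^-1 - t|)%R by rewrite mulr_ge0// ltW.
      have : (pi * `|2^-1 - t| <= pi / 2)%R by rewrite ler_pM2l.
      by move=> ? ?; apply/andP; split; lra.
    - by rewrite asin_geNpi2// asin_lepi2.
  have Habs t : (`|2^-1 - t| < a)%R = (2^-1 - a < t < 2^-1 + a)%R.
    by rewrite ltr_norml; apply/idP/idP => /andP[? ?]; apply/andP; split; lra.
  apply/seteqP; split => t /=; rewrite !in_itv/=.
    move=> [/andP[t0 t1]]; rewrite H ?Habs//.
    by rewrite ler_norml; apply/andP; split; lra.
  move=> /[dup] /andP[t0 t1]; rewrite -Habs => h; split; last first.
    by rewrite H// (le_trans (ltW h)).
  by apply/andP; split; lra.
rewrite lebesgue_measure_itv/= lte_fin; case: ifPn => h.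
  by rewrite -EFinD; congr EFin; rewrite -apiE mulrA divfK ?gt_eqF//; ring.
have -> : asin z = 0%R by rewrite -apiE (_ : a = 0%R) ?mulr0//; lra.
by rewrite mulr0.
Qed.

Let r (t : R) : R := (2 * `|cos (pi * t)|)%R.

Let r_ge0 t : (0 <= r t)%R. Proof. by rewrite mulr_ge0. Qed.

Let r_le2 t : (r t <= 2)%R.
Proof. by rewrite -[leRHS]mulr1 ler_pM2l// cos_max. Qed.

Let mr (D : set R) : measurable_fun D r.
Proof.
apply/measurable_funTS; apply: measurable_funM => //; apply: measurableT_comp => //.
by apply: continuous_measurable_fun => x; apply: continuous_comp; [exact: mulrl_continuous|exact: continuous_cos].
Qed.

(** Layer-cake kernel: its integral in y over ]x, 2[ is ln 2 - ln max(r t, x), and its integral in t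
    is the distribution function of r divided by y. On the relevant range the power is y^-1. *)
Let f (yt : R * R) : \bar R := (if r yt.2 < yt.1 then yt.1 `^ (-1) else 0)%:E.

Let f_ge0 yt : 0 <= f yt.
Proof. by rewrite /f; case: ifP => _; rewrite lee_fin// powR_ge0. Qed.

Let mf : measurable_fun setT f.
Proof.
apply/measurable_EFinP; apply: measurable_fun_ifT => //.
- apply: measurable_fun_ltr => //; apply: measurableT_comp => //; exact: mr.
- by apply: (@measurableT_comp _ _ _ _ _ _ (fun y => y `^ (-1)))%R.
Qed.

Let h y := \int[mu]_(t in `[0%R, 1%R[) f (y, t).

Let h_ge0 y : 0 <= h y. Proof. exact: integral_ge0. Qed.

Let mh (D : set R) : measurable_fun D h.
Proof.
by apply/measurable_funTS; exact: (@ge0_integral_prod_measurable _ _ _ _ R mu `[0%R, 1%R[ _ (measurable_itv _) mf f_ge0).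
Qed.

Let hE y : (0 < y <= 2)%R -> h y = (2 / pi * (asin (y / 2) / y))%:E.
Proof.
move=> /andP[y0 y2].
transitivity (\int[mu]_(t in `[0%R, 1%R[ `&` [set t | `|cos (pi * t)| < y / 2]%R) y^-1%:E).
  rewrite integral_mkcondr; apply: eq_integral => t _; rewrite /f patchE.
  have -> : (t \in [set t | `|cos (pi * t)| < y / 2]%R) = (r t < y)%R.
    by apply/idP/idP; rewrite inE/= ltr_pdivlMr// [X in (X < y)%R]mulrC.
  rewrite /=; case: ifP => //.
  by rewrite powR_inv1// ltW.
have mS : measurable (`[0%R, 1%R[ `&` [set t | `|cos (pi * t)| < y / 2]%R : set R).
  rewrite (_ : [set t | `|cos (pi * t)| < y / 2]%R = [set t | r t < y]%R); last first.
    by apply/seteqP; split => t /=; rewrite ltr_pdivlMr// [X in (X < y)%R]mulrC.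
  have := mr (measurable_itv `[0%R, 1%R[%R) (measurable_itv `]-oo, y[%R).
  by congr measurable; congr setI; apply/seteqP; split => t /=; rewrite in_itv.
have := @integral_cst _ _ _ mu _ mS y^-1%:E; rewrite /cst => ->.
rewrite -[X in _ * X]/(mu _) measure_cos_lt; last first.
  by rewrite divr_ge0 ?(ltW y0)//= ler_pdivrMr// mul1r.
by rewrite -EFinM; congr EFin; ring.
Qed.

(** A positive maximum is required: for r t = x = 0 the integral diverges, whereas [ln 0 = 0]. In
    [FE] this exception is the zero of 1 + e(t). *)
Let inner x t : (0 <= x <= 2)%R -> (0 < Num.max (r t) x)%R ->
  \int[mu]_(y in `]x, 2%R[) f (y, t) = (ln 2 - ln (Num.max (r t) x))%:E.
Proof.
move=> /andP[x0 x2] m0; set m := Num.max _ _ in m0 *.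
have m2 : (m <= 2)%R by rewrite ge_max r_le2.
transitivity (\int[mu]_(y in `]m, 2%R[) y^-1%:E).
  have -> : `]m, 2%R[%classic = `]x, 2%R[ `&` [set y | r t < y]%R.
    apply/seteqP; split => y /=; rewrite !in_itv/= /m gt_max.
      by move=> /andP[/andP[-> ->] ->].
    by move=> [/andP[-> ->] ->].
  rewrite integral_mkcondr; apply: eq_integral => y; rewrite inE/= in_itv/= => /andP[xy _].
  rewrite patchE (_ : (y \in [set y | r t < y]%R) = (r t < y)%R); last by apply/idP/idP; rewrite inE.
  rewrite /f/=; case: ifP => // _.
  by rewrite powR_inv1// (le_trans x0)// ltW.
refine (@integral_itv_derive false true (fun y => y^-1)%R (@ln R) m 2%R m2 _ _).
- move=> y /andP[my _]; exact: is_derive1_ln (lt_le_trans m0 my).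
- by move=> y /andP[my _]; apply: inv_continuous; rewrite gt_eqF// (lt_le_trans m0).
Qed.

Let F x := \int[mu]_(t in `[0%R, 1%R[) (ln 2 - ln (Num.max (r t) x))%:E.

Let max2 t x : (x <= 2 -> Num.max (r t) x <= 2)%R.
Proof. by move=> x2; rewrite ge_max r_le2. Qed.

Let F_ge0 t x : (x <= 2)%R -> (0 <= ln 2 - ln (Num.max (r t) x))%R.
Proof. by move=> x2; rewrite subr_ge0 ge0_le_ln ?max2 ?ler1n// le_max r_ge0. Qed.

Let mF x (D : set R) : measurable_fun D (fun t => (ln 2 - ln (Num.max (r t) x))%:E).
Proof.
apply/measurable_EFinP; apply: measurable_funB => //; apply: measurableT_comp => //.
by apply: measurable_maxr => //; exact: mr.
Qed.

Let FE x : (0 <= x <= 2)%R -> F x = \int[mu]_(y in `]x, 2%R[) h y.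
Proof.
move=> x02; have /andP[x0 x2] := x02.
rewrite /h (@ge0_integral_prod_swap _ _ _ _ R mu mu `]x, 2%R[ `[0%R, 1%R[ f)//.
have nn : mu.-negligible [set t | `[0%R, 1%R[ t /\ (1 + 1 * e2pi t = 0 :> R[i])%R].
  by apply: negligible_zeros; rewrite oner_eq0.
have mft : measurable_fun setT (fun z : R * R => f (z.2, z.1)).
  by apply: (measurableT_comp mf); exact: measurable_fun_pair.
apply: ge0_ae_eq_integral => //.
- exact: mF.
- apply/measurable_funTS; exact: (@ge0_integral_prod_measurable _ _ _ _ R mu `]x, 2%R[ _ (measurable_itv _) mft (fun _ => f_ge0 _)).
- by move=> t _; rewrite lee_fin F_ge0.
- by move=> t _; exact: integral_ge0.
apply: (negligibleS _ nn) => t /= /not_implyP[tI tE]; split => //.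
apply: Normc.eq0_normc; rewrite mul1r normc_onePe2pi -/(r t).
apply/eqP; rewrite eq_le r_ge0 andbT leNgt; apply/negP => rt0; apply: tE.
by rewrite inner// lt_max rt0.
Qed.

(** Jensen's formula for 1 + e(t), on the boundary |w| = 1. It supplies the total integral of [h]
    over ]0, 2[. *)
Let F0 : F 0%R = (ln 2)%:E.
Proof.
rewrite -(@integral_ln_onePe2pi R 1%R (ln 2)) ?Normc.normc1//.
apply: eq_integral => t _; rewrite mul1r normc_onePe2pi -/(r t) max_l//.
Qed.

Let alg1 (p y q e b yk : R) : p != 0%R -> y != 0%R -> q != 0%R -> e != 0%R ->
  (2 / p * (b / q / e) * yk = 2 / p / y * (b / q * (y * yk / e)))%R.
Proof. by move=> *; field; apply/and4P. Qed.

Let alg2 (p q e b xk : R) : p != 0%R -> q != 0%R -> e != 0%R ->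
  (2 / p * (b / q ^+ 2 * (xk / e)) = 2 / p * (b / q / e) * xk / q)%R.
Proof. by move=> *; field; apply/and3P. Qed.

(** Split F 0 = ln 2 at x: what remains above x is F x, and the part over ]0, x] is the arcsine
    series integrated against dy / y, which accounts for the second factor 2k + 1. The strict bound
    x < 2 keeps y / 2 < 1. A sum is stated so that no extended real is subtracted. *)
Lemma integral_ln_max (x : R) : (0 <= x < 2)%R ->
  \int[mu]_(t in `[0%R, 1%R[) (ln 2 - ln (Num.max (2 * `|cos (pi * t)|) x))%:E +
  \sum_(k <oo) (2 / pi * (bcoef k / (2 * k).+1%:R ^+ 2 * (x / 2) ^+ (2 * k).+1))%:E = (ln 2)%:E.
Proof.
move=> /andP[x0 x2]; rewrite -/(F x) FE ?x0 ?ltW// -F0 FE ?lexx//=.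
have -> : `]0%R, 2%R[%classic = `]0%R, x] `|` `]x, 2%R[ :> set R.
  by apply: itv_bndbnd_setU; rewrite bnd_simp.
rewrite [RHS]ge0_integral_setU//; last 2 first.
- exact: mh.
- rewrite disj_set2E; apply/eqP; rewrite -subset0 => y []/=; rewrite !in_itv/=.
  by move=> /andP[_ y1] /andP[y2 _]; move: y1; rewrite leNgt y2.
rewrite addeC; congr (_ + _).
transitivity (\int[mu]_(y in `]0%R, x])
   \sum_(k <oo) (2 / pi * (bcoef k / (2 * k).+1%:R / 2 ^+ (2 * k).+1) * y ^+ (2 * k))%:E); last first.
  apply: eq_integral => y; rewrite inE/= in_itv/= => /andP[y0 yx].
  rewrite hE; last by rewrite y0 (le_trans yx)// ltW.
  rewrite mulrA mulrAC EFinM asin_nneseries; last first.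
    by rewrite divr_ge0 ?ltW//= ltr_pdivrMr// mul1r (le_lt_trans yx).
  rewrite -nneseriesZl; last first.
    move=> k _; rewrite lee_fin; apply: mulr_ge0.
      by apply: divr_ge0 => //; exact/ltW/bcoef_gt0.
    by rewrite exprn_ge0// divr_ge0// ltW.
  apply: eq_eseriesr => k _; rewrite -EFinM; congr EFin.
  rewrite expr_div_n [(y ^+ _.+1)%R]exprS.
  by apply: alg1; rewrite ?expf_neq0 ?pnatr_eq0 ?gt_eqF ?pi_gt0.
rewrite integral_nneseries//.
- apply: eq_eseriesr => k _; rewrite integral_itv_exprn//; congr EFin.
  by rewrite expr_div_n; apply: alg2; rewrite ?expf_neq0 ?pnatr_eq0 ?gt_eqF ?pi_gt0.
- by move=> k; apply/measurable_EFinP; apply: measurable_funM => //; exact: measurable_funX.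
- move=> k y /=; rewrite in_itv/= => /andP[y0 _].
  rewrite lee_fin; apply: mulr_ge0; last by rewrite exprn_ge0// ltW.
  apply: mulr_ge0; first by rewrite divr_ge0// pi_ge0.
  apply: divr_ge0; last by rewrite exprn_ge0.
  by apply: divr_ge0 => //; exact/ltW/bcoef_gt0.
Qed.

End layer_cake.

(** * Gamma function and cosine moments *)

Section gamma.
Context {R : realType}.
Notation mu := (@lebesgue_measure R).
Local Open Scope ereal_scope.
Implicit Types a s t u : R.

Lemma powRD_gt0 t a b : (0 < t)%R -> (t `^ (a + b) = t `^ a * t `^ b)%R.
Proof. by move=> t0; rewrite powRD// (gt_eqF t0) implybT. Qed.

Lemma powR_continuous a t : (0 < t)%R -> {for t, continuous (fun x => x `^ a)%R}.
Proof.
move=> t0; apply/differentiable_continuous/derivable1_diffP.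
by have [] := @is_derive1_powR R a t t0.
Qed.

(** The integral behind [Gamma] before [fine] is applied; identities hold in [0, +oo], and
    finiteness is deduced from them afterwards. *)
Definition eGamma a := \int[mu]_(t in `]0%R, +oo[) (t `^ (a - 1) * expR (- t))%:E.

Lemma eGamma_ge0 a : 0 <= eGamma a.
Proof. by apply: integral_ge0 => t _; rewrite lee_fin mulr_ge0 ?powR_ge0 ?expR_ge0. Qed.

Lemma fine_eGamma a : Gamma a = fine (eGamma a).
Proof. by []. Qed.

Let m_exp d (T : measurableType d) (D : set T) (f : T -> R) : measurable_fun setT f ->
  measurable_fun D (fun x => expR (f x)).
Proof. by move=> mf; apply/measurable_funTS; exact: measurableT_comp. Qed.

Let m_pow d (T : measurableType d) (D : set T) (f : T -> R) a : measurable_fun setT f ->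
  measurable_fun D (fun x => f x `^ a)%R.
Proof.
by move=> mf; apply/measurable_funTS; exact: (@measurableT_comp _ _ _ _ _ _ (@powR R ^~ a)).
Qed.

Let mg a b s (D : set R) : measurable_fun D (fun t => (t `^ a * expR (- (s * t)) * b)%:E).
Proof.
apply/measurable_EFinP; do 2 (apply: measurable_funM => //); first exact: m_pow.
by apply: m_exp; apply: measurableT_comp => //; exact: measurable_funM.
Qed.

Let mg1 a (D : set R) : measurable_fun D (fun t => (t `^ a * expR (- t))%:E).
Proof.
have := mg a 1 1 (D := D); congr measurable_fun.
by apply/funext => t; rewrite mulr1 mul1r.
Qed.

Let dilate_itv s : (0 < s)%R ->
  ((fun x : R => (s * x + 0)%R) @^-1` `]0%R, +oo[) = `]0%R, +oo[.
Proof.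
by move=> s0; apply/seteqP; split => x /=; rewrite !in_itv/= !andbT addr0 pmulr_rgt0.
Qed.

Lemma eGamma_dilate a s : (0 < s)%R ->
  \int[mu]_(t in `]0%R, +oo[) (t `^ (a - 1) * expR (- (s * t)))%:E = (s `^ (- a))%:E * eGamma a.
Proof.
move=> s0; have sa : (s `^ (- a) * s * s `^ (a - 1) = 1)%R.
  rewrite -[RHS](powRr0 s) -[0%R in RHS](subrr a) (_ : a - a = - a + 1 + (a - 1))%R; last ring.
  by rewrite !powRD_gt0// powRr1// ltW.
rewrite /eGamma [in RHS](@ge0_integral_affine _ s 0 s0 `]0%R, +oo[)//.
rewrite dilate_itv// muleA -EFinM -ge0_integralZl_EFin//.
- apply: eq_integral => t; rewrite inE/= in_itv/= andbT => t0.
  rewrite addr0 -EFinM powRM ?ltW//; congr EFin.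
  by rewrite 2!mulrA sa mul1r.
- by move=> t _; rewrite lee_fin mulr_ge0 ?powR_ge0 ?expR_ge0.
- apply: (@measurableT_comp _ _ _ _ _ _ (fun t => (t `^ (a - 1) * expR (- t))%:E)); first exact: mg1.
  by apply: measurable_funD => //; exact: measurable_funM.
- by rewrite mulr_ge0 ?powR_ge0 ?ltW.
- by move=> t _; rewrite lee_fin mulr_ge0 ?powR_ge0 ?expR_ge0.
Qed.

(** Euler's B(a, a) in its form on the half-line. *)
Definition eBeta a := \int[mu]_(u in `]0%R, +oo[) (u `^ (a - 1) * (1 + u) `^ (- (2 * a)))%:E.

(** Substitute t = s u in one factor, exchange the integrals, and absorb exp(-(1 + u) s) by
    [eGamma_dilate]. *)
Lemma eGamma_sqr a : eGamma a * eGamma a = eBeta a * eGamma (2 * a).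
Proof.
pose phi (su : R * R) := (su.1 `^ (2 * a - 1) * expR (- ((1 + su.2) * su.1)) * su.2 `^ (a - 1))%R.
have phi0 su : 0 <= (phi su)%:E by rewrite lee_fin !mulr_ge0 ?powR_ge0 ?expR_ge0.
have mphi : measurable_fun setT (EFin \o phi).
  rewrite /phi; apply/measurable_EFinP; apply: measurable_funM; last exact: m_pow.
  apply: measurable_funM; first exact: m_pow.
  apply: m_exp; apply: measurableT_comp => //; apply: measurable_funM => //.
  exact: measurable_funD.
transitivity (\int[mu]_(s in `]0%R, +oo[) \int[mu]_(u in `]0%R, +oo[) (phi (s, u))%:E).
  rewrite {1}/eGamma -ge0_integralZr//; last 3 first.
  - exact: mg1.
  - by move=> t _; rewrite lee_fin mulr_ge0 ?powR_ge0 ?expR_ge0.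
  - exact: eGamma_ge0.
  apply: eq_integral => s; rewrite inE/= in_itv/= andbT => s0.
  rewrite /eGamma [in LHS](@ge0_integral_affine _ s 0 s0 `]0%R, +oo[)//; last first.
    by move=> t _; rewrite lee_fin mulr_ge0 ?powR_ge0 ?expR_ge0.
  rewrite dilate_itv// muleA -EFinM -ge0_integralZl_EFin//.
  - apply: eq_integral => u; rewrite inE/= in_itv/= andbT => u0.
    rewrite addr0 -EFinM powRM ?ltW// /phi/=; congr EFin.
    rewrite (_ : 2 * a - 1 = (a - 1) + 1 + (a - 1))%R; last ring.
    rewrite !powRD_gt0// powRr1 ?ltW//.
    rewrite (_ : - ((1 + u) * s) = - s + - (s * u))%R ?expRD; ring.
  - by move=> t _; rewrite lee_fin mulr_ge0 ?powR_ge0 ?expR_ge0.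
  - apply: (@measurableT_comp _ _ _ _ _ _ (fun t => (t `^ (a - 1) * expR (- t))%:E)); first exact: mg1.
    by apply: measurable_funD => //; exact: measurable_funM.
  - by rewrite !mulr_ge0 ?powR_ge0 ?expR_ge0 ?ltW.
rewrite (@ge0_integral_prod_swap _ _ _ _ R mu mu `]0%R, +oo[ `]0%R, +oo[ (EFin \o phi))//.
rewrite /eBeta -ge0_integralZr//; last 3 first.
- apply/measurable_EFinP; apply: measurable_funM; first exact: m_pow.
  by apply: m_pow; exact: measurable_funD.
- by move=> t _; rewrite lee_fin mulr_ge0 ?powR_ge0.
- exact: eGamma_ge0.
apply: eq_integral => u; rewrite inE/= in_itv/= andbT => u0.
have u10 : (0 < 1 + u)%R by rewrite addr_gt0.
transitivity ((u `^ (a - 1))%:E * \int[mu]_(s in `]0%R, +oo[)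
    (s `^ (2 * a - 1) * expR (- ((1 + u) * s)))%:E); last first.
  by rewrite eGamma_dilate// muleA -EFinM.
rewrite -[RHS]ge0_integralZl_EFin ?powR_ge0//.
- by apply: eq_integral => s _; rewrite -EFinM /phi/=; congr EFin; ring.
- by move=> t _; rewrite lee_fin mulr_ge0 ?powR_ge0 ?expR_ge0.
- have := mg (2 * a - 1) 1 (1 + u) (D := `]0%R, +oo[%classic); congr measurable_fun.
  by apply/funext => t; rewrite mulr1.
Qed.

Lemma integral_expRN t : \int[mu]_(s in `]t, +oo[) (expR (- s))%:E = (expR (- t))%:E.
Proof.
have mE (D : set R) : measurable_fun D (fun s => (expR (- s))%:E).
  by apply/measurable_EFinP; exact: m_exp.
have dF (x : R) : is_derive x (1 : R)%R (fun s => - expR (- s))%R (expR (- x)).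
  have -> : expR (- x) = (- (- expR (- x)))%R by rewrite opprK.
  apply: is_deriveN; rewrite -mulN1r mulrC.
  exact: (@is_derive1_comp _ expR -%R).
have cF : continuous (fun s : R => - expR (- s))%R.
  by move=> x; apply/differentiable_continuous/derivable1_diffP; have [] := dF x.
rewrite integral_itv_obnd_cbnd//.
rewrite (@ge0_continuous_FTC2y _ _ (fun s => - expR (- s))%R t 0%R).
- by rewrite sub0e -EFinN opprK.
- by move=> x _; exact: expR_ge0.
- apply: continuous_subspaceT => x; apply: continuous_comp; first exact: continuousN.
  exact: continuous_expR.
- by rewrite -oppr0; apply: cvgN; exact: cvgr_expR.
- by move=> x _; have [] := dF x.
- by apply: cvg_at_right_filter; exact: cF.
- by move=> x _; rewrite derive1E; have [] := dF x.
Qed.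

Lemma eGamma1 : eGamma 1 = 1.
Proof.
transitivity (\int[mu]_(s in `]0%R, +oo[) (expR (- s))%:E); last first.
  by rewrite integral_expRN oppr0 expR0.
by apply: eq_integral => t _; rewrite subrr powRr0 mul1r.
Qed.

(** For a < 1 the integrand is unbounded at 0, so the fundamental theorem is applied on
    [s / (n+1), s] and n tends to infinity. *)
Lemma integral_powR a s : (0 < a)%R -> (0 < s)%R ->
  \int[mu]_(t in `]0%R, s[) (a * t `^ (a - 1))%:E = (s `^ a)%:E.
Proof.
move=> a0 s0.
have mf (D : set R) : measurable_fun D (fun t => (a * t `^ (a - 1))%:E).
  by apply/measurable_EFinP; apply: measurable_funM => //; exact: m_pow.
rewrite integral_itv_bndo_bndc//.
pose e n : R := (s / n.+1%:R)%R.
have e0 n : (0 < e n)%R by rewrite divr_gt0.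
have es n : (e n <= s)%R by rewrite ler_pdivrMr// ler_peMr ?ler1n// ltW.
have eU : `]0%R, s]%classic = \bigcup_n `[e n, s] :> set R.
  apply/seteqP; split => [t /=|t [n _] /=]; rewrite !in_itv/=.
    move=> /andP[t0 ts]; exists (Num.bound (s / t)) => //=; rewrite in_itv/= ts andbT.
    have := archi_boundP (divr_ge0 (ltW s0) (ltW t0)).
    rewrite ltr_pdivrMr// => h; rewrite /e ler_pdivrMr// mulrC (le_trans (ltW h))//.
    by rewrite ler_pM2r// ler_nat.
  by move=> /andP[et ->]; rewrite (lt_le_trans (e0 n) et).
have cvgI : \int[mu]_(t in `[e i, s]) (a * t `^ (a - 1))%:E @[i --> \oo] -->
    \int[mu]_(t in `]0%R, s]) (a * t `^ (a - 1))%:E.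
  rewrite eU; apply: ge0_nondecreasing_set_cvg_integral => //; last 2 first.
  - by move=> i; exact: mf.
  - by move=> i t _; rewrite lee_fin mulr_ge0 ?powR_ge0// ltW.
  - move=> i j ij; apply/subsetPset => t /=; rewrite !in_itv/= => /andP[h ->]; rewrite andbT.
    by rewrite (le_trans _ h)// ler_pM2l// lef_pV2 ?posrE// ler_nat ltnS.
have cvgF : \int[mu]_(t in `[e i, s]) (a * t `^ (a - 1))%:E @[i --> \oo] --> (s `^ a)%:E.
  rewrite (_ : (fun i => _) = (fun i => (s `^ a - (e i) `^ a)%:E)); last first.
    apply/funext => i; refine (@integral_itv_derive _ true false (fun x => a * x `^ (a - 1))%R
      (fun x => x `^ a)%R (e i) s (es i) _ _).
      by move=> x /andP[ex _]; apply: is_derive1_powR; exact: lt_le_trans (e0 i) ex.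
    move=> x /andP[ex _]; have cp := @powR_continuous (a - 1) x (lt_le_trans (e0 i) ex).
    apply: (@continuousM R R (cst a) (fun y : R => y `^ (a - 1))%R x) => //.
    exact: cst_continuous.
  apply: cvg_EFin; first exact: nearW.
  rewrite -[X in _ --> X]subr0; apply: cvgB; first exact: cvg_cst.
  have e_0 : e i @[i --> \oo] --> 0%R^'+.
    move=> A [d /= d0 dA].
    have : e i @[i --> \oo] --> 0%R.
      rewrite -(mulr0 s); apply: cvgM; first exact: cvg_cst.
      exact: cvg_harmonic.
    by move=> /cvgrPdist_lt/(_ _ d0); apply: filterS => i h; apply: dA => /=.
  exact: (cvg_comp _ _ e_0 (powR_cvg0 a0)).
exact: (cvg_unique _ cvgI cvgF).
Qed.

(** Tonelli instead of integration by parts: with s^a the integral of a t^(a-1) over ]0, s[ and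
    exp(-t) the integral of exp(-s) over ]t, +oo[, both sides are one double integral over 0 < t <
    s. *)
Lemma eGammaD1 a : (0 < a)%R -> eGamma (a + 1) = a%:E * eGamma a.
Proof.
move=> a0.
pose f (ts : R * R) : \bar R := (if ts.1 < ts.2 then a * ts.1 `^ (a - 1) * expR (- ts.2) else 0)%:E.
have f0 ts : 0 <= f ts.
  by rewrite /f; case: ifP => _; rewrite lee_fin// !mulr_ge0 ?powR_ge0 ?expR_ge0// ltW.
have mf : measurable_fun setT f.
  apply/measurable_EFinP; apply: measurable_fun_ifT => //; first exact: measurable_fun_ltr.
  apply: measurable_funM; last by apply: m_exp; exact: measurableT_comp.
  by apply: measurable_funM => //; exact: m_pow.
have mlt (t : R) (P : R -> bool) (y : R) : (y \in [set y | P y]) = P y.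
  by apply/idP/idP; rewrite inE.
transitivity (\int[mu]_(t in `]0%R, +oo[) \int[mu]_(s in `]0%R, +oo[) f (t, s)); last first.
  rewrite /eGamma -ge0_integralZl_EFin//; last 3 first.
  - by move=> t _; rewrite lee_fin mulr_ge0 ?powR_ge0 ?expR_ge0.
  - exact: mg1.
  - exact: ltW.
  apply: eq_integral => t; rewrite inE/= in_itv/= andbT => t0.
  transitivity (\int[mu]_(s in `]t, +oo[) ((a * t `^ (a - 1))%:E * (expR (- s))%:E)).
    have -> : `]t, +oo[%classic = `]0%R, +oo[ `&` [set s | t < s]%R.
      apply/seteqP; split => s /=; rewrite !in_itv/= !andbT; last by case.
      by move=> ts; rewrite (lt_trans t0).
    rewrite integral_mkcondr; apply: eq_integral => s _; rewrite patchE mlt//= /f/=.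
    by case: ifP.
  rewrite ge0_integralZl_EFin//.
  - by rewrite integral_expRN -!EFinM mulrA.
  - by apply/measurable_EFinP; exact: m_exp.
  - by rewrite mulr_ge0 ?powR_ge0// ltW.
rewrite (@ge0_integral_prod_swap _ _ _ _ R mu mu `]0%R, +oo[ `]0%R, +oo[ f)//.
rewrite /eGamma addrK; apply: eq_integral => s; rewrite inE/= in_itv/= andbT => s0.
transitivity (\int[mu]_(t in `]0%R, s[) ((expR (- s))%:E * (a * t `^ (a - 1))%:E)).
  rewrite ge0_integralZl_EFin//.
  - by rewrite integral_powR// -EFinM mulrC.
  - by move=> t _; rewrite lee_fin mulr_ge0 ?powR_ge0// ltW.
  - by apply/measurable_EFinP; apply: measurable_funM => //; exact: m_pow.
have -> : `]0%R, s[%classic = `]0%R, +oo[ `&` [set t | t < s]%R.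
  apply/seteqP; split => t /=; rewrite !in_itv/= ?andbT; first by move=> /andP[].
  by move=> [-> ->].
rewrite integral_mkcondr; apply: eq_integral => t _; rewrite patchE mlt//= /f/=.
by case: ifP => // _; rewrite -EFinM mulrC.
Qed.

End gamma.

(** * Diagonal Beta values as cosine moments *)

Section cos_moment.
Context {R : realType}.
Notation mu := (@lebesgue_measure R).
Local Open Scope ereal_scope.

(** The margin ]c, d[ around [a, b] lets the one-sided conditions at the endpoints follow from
    ordinary continuity. *)
Lemma integration_by_substitution_derive (F f G : R -> R) (c d a b : R) :
  (c < a)%R -> (a <= b)%R -> (b < d)%R ->
  (forall x, (c < x < d)%R -> is_derive x (1 : R)%R F (f x)) ->
  (forall x, (c < x < d)%R -> {for x, continuous f}) ->
  {in `[a, b]%R &, {homo F : x y / (x < y)%R}} ->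
  (forall u, (F a <= u <= F b)%R -> {for u, continuous G}) ->
  \int[mu]_(u in `[F a, F b]) (G u)%:E = \int[mu]_(x in `[a, b]) (G (F x) * f x)%:E.
Proof.
move=> ca ab bd dF cf homoF cG.
have cab x : (a <= x <= b)%R -> (c < x < d)%R.
  by move=> /andP[ax xb]; rewrite (lt_le_trans ca ax) (le_lt_trans xb bd).
have dFE x : (c < x < d)%R -> (F^`() x = f x)%classic.
  by move=> xcd; rewrite derive1E; have [] := dF x xcd.
have cF' x : (c < x < d)%R -> {for x, continuous F^`()%classic}.
  move=> xcd; suff : F^`()%classic y @[y --> x] --> f x by rewrite -(dFE x xcd).
  apply: cvg_trans (cf x xcd); apply: near_eq_cvg.
  have : x \in `]c, d[%R by rewrite in_itv/=.
  move=> /near_in_itvoo; apply: filterS => y; rewrite in_itv/= => ycd.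
  by rewrite dFE.
have cF x : (c < x < d)%R -> {for x, continuous F}.
  move=> xcd; apply/differentiable_continuous/derivable1_diffP.
  by have [] := dF x xcd.
rewrite (@integration_by_substitution_increasing _ F G a b)//.
- apply: eq_integral => x; rewrite inE/= in_itv/= => xab.
  by rewrite /= fctE dFE// cab.
- move=> x; rewrite in_itv/= => /andP[ax xb]; apply: cF'; apply: cab.
  by rewrite !ltW.
- apply/cvg_ex; exists (F^`() a)%classic; apply: cvg_at_right_filter; apply: cF'.
  by apply: cab; rewrite lexx.
- apply/cvg_ex; exists (F^`() b)%classic; apply: cvg_at_left_filter; apply: cF'.
  by apply: cab; rewrite lexx ab.
- split.
  + by move=> x; rewrite in_itv/= => /andP[ax xb]; have [] := dF x; rewrite ?cab// !ltW.
  + by apply: cvg_at_right_filter; apply: cF; apply: cab; rewrite lexx.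
  + by apply: cvg_at_left_filter; apply: cF; apply: cab; rewrite lexx ab.
- apply: continuous_in_subspaceT => u /[1!inE]/=; rewrite in_itv/=; exact: cG.
Qed.

Definition cos_moment (p : R) :=
  \int[mu]_(x in `](- (pi / 2))%R, (pi / 2)%R[) (cos x `^ p)%:E.

(* [psi x = (1 + sin x) / (1 - sin x)]; substituting it for the variable turns
   [eBeta] into a cosine moment. *)
Let psi (x : R) : R := (2 * (1 - sin x)^-1 - 1)%R.
Let dpsi (x : R) : R := (2 * (cos x * (1 - sin x) ^- 2))%R.

Let sin_bd (x : R) : (- (pi / 2) < x < pi / 2)%R -> (-1 < sin x < 1)%R.
Proof.
move=> /andP[x1 x2]; have pi0 := @pi_gt0 R.
have xI : x \in `[- (pi / 2), pi / 2]%R by rewrite in_itv/= !ltW.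
have pI : (pi / 2 : R)%R \in `[- (pi / 2), pi / 2]%R by rewrite in_itv/=; apply/andP; split; lra.
have nI : (- (pi / 2) : R)%R \in `[- (pi / 2), pi / 2]%R by rewrite in_itv/=; apply/andP; split; lra.
by rewrite -(@sin_pihalf R) -sinN !ltr_sin// x1 x2.
Qed.

Let is_derive_psi (x : R) : (- (pi / 2) < x < pi / 2)%R -> is_derive x (1 : R)%R psi (dpsi x).
Proof.
move=> /sin_bd/andP[_ s1].
have n0 : (1 - sin x != 0)%R by rewrite subr_eq0 eq_sym lt_eqF.
have d1 : is_derive x (1 : R)%R (fun x => 1 - sin x)%R (0 - cos x)%R.
  by apply: is_deriveB.
have d2 : is_derive x (1 : R)%R (fun x => (1 - sin x)^-1)%R (- (1 - sin x) ^- 2 *: (0 - cos x))%R.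
  exact: is_deriveV.
have d3 : is_derive x (1 : R)%R psi (2 *: (- (1 - sin x) ^- 2 *: (0 - cos x)) - 0)%R.
  apply: is_deriveB; exact: (@is_deriveZ _ _ _ (fun x => (1 - sin x)^-1)%R 2 x 1%R _ d2).
have -> : dpsi x = (2 *: (- (1 - sin x) ^- 2 *: (0 - cos x)) - 0)%R; last exact: d3.
by rewrite /dpsi /GRing.scale/=; ring.
Qed.

(** The definition contains sin x once, which suits differentiation and monotonicity; this quotient
    suits signs and algebra. *)
Let psiE (x : R) : (- (pi / 2) < x < pi / 2)%R -> psi x = ((1 + sin x) / (1 - sin x))%R.
Proof.
move=> /sin_bd/andP[_ s1]; rewrite /psi; field.
by rewrite subr_eq0 eq_sym lt_eqF.
Qed.

Let psi_gt0 (x : R) : (- (pi / 2) < x < pi / 2)%R -> (0 < psi x)%R.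
Proof.
move=> x12; rewrite psiE//; move/sin_bd: x12 => /andP[s1 s2].
by apply: divr_gt0; lra.
Qed.

Let psi_homo (x y : R) : (- (pi / 2) < x)%R -> (y < pi / 2)%R -> (x < y)%R -> (psi x < psi y)%R.
Proof.
move=> x1 y2 xy.
have x12 : (- (pi / 2) < x < pi / 2)%R by rewrite x1 (lt_trans xy).
have y12 : (- (pi / 2) < y < pi / 2)%R by rewrite y2 (lt_trans x1).
have /andP[sx1 sx2] := sin_bd x12; have /andP[sy1 sy2] := sin_bd y12.
rewrite ltrD2r ltr_pM2l// ltf_pV2 ?posrE ?subr_gt0// ltrD2l ltrN2 ltr_sin//;
by rewrite in_itv/=; apply/andP; split; apply: ltW; lra.
Qed.

(** From psi = cos^2 / (1 - sin)^2 and 1 + psi = 2 / (1 - sin), every factor is a monomial in 2, cos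
    x and 1 - sin x. Written as exponentials of [l], [p], [q], the claim is linear, and [q]
    cancels. *)
Let beta_integrand (a x : R) : (- (pi / 2) < x < pi / 2)%R ->
  (psi x `^ (a - 1) * (1 + psi x) `^ (- (2 * a)) * dpsi x = 2 `^ (1 - 2 * a) * cos x `^ (2 * a - 1))%R.
Proof.
move=> x12; have c0 : (0 < cos x)%R by exact: cos_gt0_pihalf.
have /andP[s1 s2] := sin_bd x12.
have D0 : (0 < 1 - sin x)%R by lra.
pose p := ln (cos x); pose q := ln (1 - sin x); pose l := ln (2 : R).
have cE : cos x = expR p by rewrite lnK.
have DE : (1 - sin x = expR q)%R by rewrite lnK.
have lE : 2%R = expR l :> R by rewrite lnK// posrE.
have -> : psi x = expR (2 * p - 2 * q)%R.
  rewrite psiE// expRB !expRM_natl -cE -DE cos2sin2; field.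
  by rewrite gt_eqF.
have -> : (1 + expR (2 * p - 2 * q) = expR (l - q))%R.
  rewrite !expRB !expRM_natl -cE -DE -lE cos2sin2; field.
  by rewrite gt_eqF.
have twoE (r : R) : (2 `^ r = expR (l * r))%R by rewrite expRM -lE.
rewrite /dpsi DE cE twoE [X in (_ * (X * _))%R = _]lE -!expRM -exprVn -expRN -!expRM_natl -!expRD.
by congr expR; ring.
Qed.

Let powc (a t : R) : (0 < t)%R -> {for t, continuous (fun x => x `^ a)%R}.
Proof. exact: powR_continuous. Qed.

(** [psi] blows up at pi / 2, so the substitution is made on compact intervals exhausting both
    domains, followed by monotone convergence. *)
Lemma eBetaE (a : R) : eBeta a = (2 `^ (1 - 2 * a))%:E * cos_moment (2 * a - 1).
Proof.
have pi0 := @pi_gt0 R.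
(* Increases to pi / 2 without reaching it; the offset 2 makes [e 0] positive. *)
pose e (n : nat) : R := (pi / 2 * (1 - n.+2%:R^-1))%R.
have e12 n : (0 < e n < pi / 2)%R.
  have h1 : (0 < (n.+2%:R : R)^-1)%R by rewrite invr_gt0.
  have h2 : ((n.+2%:R : R)^-1 < 1)%R by rewrite invf_lt1 ?ltr1n.
  rewrite /e mulr_gt0 ?divr_gt0 ?subr_gt0//= -[ltRHS]mulr1 ltr_pM2l ?divr_gt0//; lra.
have eI n : (- (pi / 2) < - e n < pi / 2)%R by have /andP[] := e12 n; lra.
have eI' n : (- (pi / 2) < e n < pi / 2)%R by have /andP[] := e12 n; lra.
have e_nd i j : (i <= j)%N -> (e i <= e j)%R.
  move=> ij; rewrite ler_pM2l ?divr_gt0// lerD2l lerN2 lef_pV2 ?posrE//.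
  by rewrite ler_nat !ltnS.
have psi_le x y : (- (pi / 2) < x)%R -> (y < pi / 2)%R -> (x <= y)%R -> (psi x <= psi y)%R.
  by move=> h1 h2; rewrite le_eqVlt => /predU1P[->//|xy]; apply/ltW/psi_homo.
have e_cover x : (- (pi / 2) < x < pi / 2)%R -> exists n, (- e n <= x <= e n)%R.
  move=> /andP[x1 x2]; have xa : (`|x| < pi / 2)%R by rewrite ltr_norml x1.
  pose d := (1 - `|x| / (pi / 2))%R.
  have d0 : (0 < d)%R by rewrite subr_gt0 ltr_pdivrMr ?divr_gt0// mul1r.
  exists (Num.bound d^-1); rewrite -ler_norml /e.
  have := archi_boundP (ltW (etrans (invr_gt0 d) d0)); set N := Num.Def.archi_bound _ => h.
  have : ((N.+2%:R : R)^-1 <= d)%R.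
    rewrite invf_ple ?posrE// (le_trans (ltW h))// ler_nat; exact: leqW (leqnSn _).
  rewrite /d lerBrDr => h2; rewrite mulrC -ler_pdivrMr ?divr_gt0//.
  by rewrite lerBrDr addrC.
have U1 : `](- (pi / 2))%R, (pi / 2)%R[%classic = \bigcup_n `[(- e n)%R, e n] :> set R.
  apply/seteqP; split => [x /=|x [n _] /=]; rewrite !in_itv/=.
    by move=> /e_cover[n xn]; exists n => //=; rewrite in_itv.
  by have := eI n; have := eI' n => /andP[? ?] /andP[? ?] /andP[? ?]; apply/andP; split; lra.
have U2 : `]0%R, +oo[%classic = \bigcup_n `[psi (- e n)%R, psi (e n)] :> set R.
  apply/seteqP; split => [u /=|u [n _] /=]; rewrite !in_itv/= ?andbT.
    (* Solves (1 + s) / (1 - s) = u, so that x = asin s is the preimage of u under [psi]. *)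
    move=> u0; pose s := ((u - 1) / (u + 1))%R.
    have u10 : (0 < u + 1)%R by lra.
    have s1 : (-1 < s)%R by rewrite ltr_pdivlMr//; lra.
    have s2 : (s < 1)%R by rewrite ltr_pdivrMr//; lra.
    pose x := asin s.
    have x12 : (- (pi / 2) < x < pi / 2)%R.
      by rewrite asin_gtNpi2 ?asin_ltpi2// ?(ltW s1) ?(ltW s2) ?s1 ?s2.
    have ux : u = psi x.
      rewrite psiE// asinK ?in_itv/= ?(ltW s1) ?(ltW s2)// /s; field.
      by apply/andP; split; rewrite gt_eqF//; lra.
    have [n /andP[n1 n2]] := e_cover x x12; exists n => //=; rewrite in_itv/= ux.
    have /andP[x1 x2] := x12; have /andP[h1 h2] := eI n; have /andP[h3 h4] := eI' n.
    by rewrite !psi_le.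
  move=> /andP[h _]; exact: lt_le_trans (psi_gt0 (eI n)) h.
pose G u : R := (u `^ (a - 1) * (1 + u) `^ (- (2 * a)))%R.
have mG (D : set R) : measurable_fun D (fun u => (G u)%:E).
  apply/measurable_funTS/measurable_EFinP; apply: measurable_funM => //.
  by apply: (@measurableT_comp _ _ _ _ _ _ (@powR R ^~ _)) => //; exact: measurable_funD.
have mcos (D : set R) : measurable_fun D (fun x => (cos x `^ (2 * a - 1))%:E).
  apply/measurable_funTS/measurable_EFinP.
  apply: (@measurableT_comp _ _ _ _ _ _ (@powR R ^~ _)) => //.
  by apply: continuous_measurable_fun; exact: continuous_cos.
have cvg1 : \int[mu]_(u in `[psi (- e i)%R, psi (e i)]) (G u)%:E @[i --> \oo] --> eBeta a.
  rewrite /eBeta U2; apply: ge0_nondecreasing_set_cvg_integral => //; last 2 first.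
  - by move=> i; exact: mG.
  - by move=> i t _; rewrite lee_fin mulr_ge0 ?powR_ge0.
  move=> i j ij; apply/subsetPset => u /=; rewrite !in_itv/= => /andP[h1 h2].
  have /andP[? ?] := eI j; have /andP[? ?] := eI' i; have /andP[? ?] := eI' j; have /andP[? ?] := eI i.
  by rewrite (le_trans _ h1) ?(le_trans h2)// psi_le// ?lerN2 e_nd.
have cvg2 : \int[mu]_(x in `[(- e i)%R, e i]) (cos x `^ (2 * a - 1))%:E @[i --> \oo] -->
    cos_moment (2 * a - 1).
  rewrite /cos_moment U1; apply: ge0_nondecreasing_set_cvg_integral => //; last 2 first.
  - by move=> i; exact: mcos.
  - by move=> i t _; rewrite lee_fin powR_ge0.
  move=> i j ij; apply/subsetPset => u /=; rewrite !in_itv/= => /andP[h1 h2].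
  by have h := e_nd _ _ ij; apply/andP; split; lra.
have cvg3 : (2 `^ (1 - 2 * a))%:E * \int[mu]_(x in `[(- e i)%R, e i]) (cos x `^ (2 * a - 1))%:E
    @[i --> \oo] --> (2 `^ (1 - 2 * a))%:E * cos_moment (2 * a - 1) by exact: cvgeZl.
suff E : (fun n => (2 `^ (1 - 2 * a))%:E * \int[mu]_(x in `[(- e n)%R, e n]) (cos x `^ (2 * a - 1))%:E) =
    (fun n => \int[mu]_(u in `[psi (- e n)%R, psi (e n)]) (G u)%:E).
  by rewrite E in cvg3; exact: (cvg_unique _ cvg1 cvg3).
apply/funext => n.
refine (etrans (esym (@ge0_integralZl_EFin _ _ _ mu _ (measurable_itv _)
  (fun x => (cos x `^ (2 * a - 1))%:E) _ (mcos _) _ (powR_ge0 _ _))) _).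
  by move=> x _; rewrite lee_fin powR_ge0.
have /andP[n1 n2] := eI n; have /andP[n3 n4] := eI' n; have /andP[n5 n6] := e12 n.
refine (etrans _ (esym (@integration_by_substitution_derive psi dpsi G
  (- (pi / 2)) (pi / 2) (- e n) (e n) n1 _ n4 is_derive_psi _ _ _))).
- apply: eq_integral => x; rewrite inE/= in_itv/= => /andP[x1 x2].
  by rewrite -EFinM /G beta_integrand//; apply/andP; split; lra.
- lra.
- move=> x /sin_bd/andP[_ s1]; change (dpsi y @[y --> x] --> dpsi x).
  have cs : (1 - sin y)%R @[y --> x] --> (1 - sin x)%R.
    by apply: cvgB; [exact: cvg_cst|exact: continuous_sin].
  apply: cvgM; first exact: cvg_cst.
  apply: cvgM; first exact: continuous_cos.
  apply: cvgV; first by rewrite expf_neq0// subr_eq0 eq_sym lt_eqF.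
  by under eq_fun do rewrite expr2; rewrite expr2; apply: cvgM.
- move=> x y; rewrite !in_itv/= => /andP[x1 x2] /andP[y1 y2]; apply: psi_homo; lra.
- move=> u /andP[u1 _]; have u0 : (0 < u)%R by exact: lt_le_trans (psi_gt0 (eI n)) u1.
  have c1 : (1 + y)%R @[y --> u] --> (1 + u)%R by apply: cvgD; [exact: cvg_cst|exact: cvg_id].
  have c2 : ((1 + y) `^ (- (2 * a)))%R @[y --> u] --> ((1 + u) `^ (- (2 * a)))%R.
    have pu := powc (a := - (2 * a)) (addr_gt0 ltr01 u0).
    refine (@continuous_cvg R R R _ _ (fun y : R => (1 + y)%R) (fun y : R => (y `^ (- (2 * a)))%R) _ pu c1).
  have c3 := powc (a := a - 1) u0.
  exact (@continuousM R R (fun y : R => (y `^ (a - 1))%R)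
    (fun y : R => ((1 + y) `^ (- (2 * a)))%R) u c3 c2).
Qed.

(** |cos (pi t)| has period 1: moving [1/2, 1[ to [-1/2, 0[ centres the period at 0, where the
    cosine is nonnegative, and scaling by pi finishes. *)
Lemma integral_cos_powR (p : R) :
  \int[mu]_(t in `[0%R, 1%R]) ((2 * `|cos (pi * t)|) `^ p)%:E = (2 `^ p / pi)%:E * cos_moment p.
Proof.
have pi0 := @pi_gt0 R.
have mc (D : set R) (h : R -> R) : measurable_fun setT h ->
    measurable_fun D (fun t => ((2 * `|cos (h t)|) `^ p)%:E).
  move=> mh; apply/measurable_funTS/measurable_EFinP.
  apply: (@measurableT_comp _ _ _ _ _ _ (@powR R ^~ _)) => //.
  apply: measurable_funM => //; apply: measurableT_comp => //.
  apply: (@measurableT_comp _ _ _ _ _ _ (@cos R)) => //.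
  by apply: continuous_measurable_fun; exact: continuous_cos.
have mcos (D : set R) : measurable_fun D (fun x => (cos x `^ p)%:E).
  apply/measurable_funTS/measurable_EFinP.
  apply: (@measurableT_comp _ _ _ _ _ _ (@powR R ^~ _)) => //.
  by apply: continuous_measurable_fun; exact: continuous_cos.
pose g t : \bar R := ((2 * `|cos (pi * t)|) `^ p)%:E.
have g0 t : 0 <= g t by rewrite lee_fin powR_ge0.
have mg (D : set R) : measurable_fun D g by apply: mc; exact: measurable_funM.
have pre1 : (fun x : R => (1 * x + 1)%R) @^-1` `[(2^-1)%R, 1%R[ = `[(- 2^-1)%R, 0%R[.
  by apply/seteqP; split => x /=; rewrite !in_itv/= mul1r => /andP[x0 x1]; apply/andP; split; lra.
transitivity (\int[mu]_(t in `](- 2^-1)%R, (2^-1)%R[) g t).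
  rewrite -/g -integral_itv_bndo_bndc; last exact: mg.
  have -> : `[0%R, 1%R[%classic = `[0%R, (2^-1)%R[ `|` `[(2^-1)%R, 1%R[ :> set R.
    by apply: itv_bndbnd_setU; rewrite bnd_simp; lra.
  rewrite ge0_integral_setU//; last 2 first.
  - exact: mg.
  - rewrite disj_set2E; apply/eqP; rewrite -subset0 => x []/=; rewrite !in_itv/=.
    by move=> /andP[_ x1] /andP[x2 _]; move: x1; rewrite ltNge x2.
  rewrite [X in _ + X](@ge0_integral_affine _ 1 1 ltr01 `[(2^-1)%R, 1%R[ g (measurable_itv _) (mg _) (fun t _ => g0 t)).
  rewrite mul1e pre1 [X in _ + X](_ : _ = \int[mu]_(x in `[(- 2^-1)%R, 0%R[) g x); last first.
    by apply: eq_integral => x _; rewrite /g mul1r mulrDr mulr1 cosDpi normrN.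
  rewrite addeC -ge0_integral_setU//; last 2 first.
  - exact: mg.
  - rewrite disj_set2E; apply/eqP; rewrite -subset0 => x []/=; rewrite !in_itv/=.
    by move=> /andP[_ x1] /andP[x2 _]; move: x1; rewrite ltNge x2.
  have <- : `[(- 2^-1)%R, (2^-1)%R[%classic = `[(- 2^-1)%R, 0%R[ `|` `[0%R, (2^-1)%R[ :> set R.
    by apply: itv_bndbnd_setU; rewrite bnd_simp; lra.
  by rewrite -integral_itv_obnd_cbnd//; exact: mg.
rewrite /cos_moment (@ge0_integral_affine _ pi 0 pi0 `](- (pi / 2))%R, (pi / 2)%R[)//; last first.
  by move=> x _; rewrite lee_fin powR_ge0.
rewrite (_ : _ @^-1` _ = `](- 2^-1)%R, (2^-1)%R[); last first.
  apply/seteqP; split => x /=; rewrite !in_itv/= addr0 -mulrN !ltr_pM2l//.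
rewrite muleA -EFinM divfK ?gt_eqF// -ge0_integralZl_EFin ?powR_ge0//.
- apply: eq_integral => x; rewrite inE/= in_itv/= => /andP[x1 x2].
  have c0 : (0 <= cos (pi * x))%R.
    apply: cos_ge0_pihalf; rewrite -mulrN !ler_pM2l//; apply/andP; split; exact: ltW.
  by rewrite addr0 /g ger0_norm// powRM.
- by move=> x _; rewrite lee_fin powR_ge0.
- apply: (@measurableT_comp _ _ _ _ _ _ (fun x => (cos x `^ p)%:E)); first exact: mcos.
  by apply: measurable_funD => //; exact: measurable_funM.
Qed.

Lemma cos_moment_ge0 (p : R) : 0 <= cos_moment p.
Proof. by apply: integral_ge0 => x _; rewrite lee_fin powR_ge0. Qed.

Lemma cos_moment0 : cos_moment 0 = pi%:E.
Proof.
rewrite /cos_moment; under eq_integral do rewrite powRr0.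
rewrite integral_itv_cst; last by have := @pi_gt0 R; lra.
by congr EFin; field.
Qed.

Lemma cos_moment_fin (p : R) : (0 <= p)%R -> cos_moment p \is a fin_num.
Proof.
move=> p0; rewrite ge0_fin_numE ?cos_moment_ge0//.
apply: (@le_lt_trans _ _ pi%:E); last exact: ltry.
rewrite -cos_moment0; have mcos (q : R) (D : set R) : measurable_fun D (fun x => (cos x `^ q)%:E).
  apply/measurable_funTS/measurable_EFinP.
  apply: (@measurableT_comp _ _ _ _ _ _ (@powR R ^~ _)) => //.
  by apply: continuous_measurable_fun; exact: continuous_cos.
apply: ge0_le_integral => //.
- by move=> x _; rewrite lee_fin powR_ge0.
- exact: mcos.
- exact: mcos.
- move=> x /=; rewrite in_itv/= => /cos_gt0_pihalf c0.
  have : (cos x `^ p <= 1 `^ p)%R by rewrite ge0_ler_powR ?nnegrE ?(ltW c0)// cos_le1.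
  by rewrite lee_fin powRr0 powR1.
Qed.

End cos_moment.

(** * The Mahler measure as a series of cosine moments *)

Section mahler_series.
Context {R : realType}.
Notation mu := (@lebesgue_measure R).
Local Open Scope ereal_scope.

(** Twice the coefficient of x^(2k+1) in [integral_ln_max]; the factor 2 comes from ln (max(r,
    x)^2). *)
Definition mahler_coef (k : nat) : R :=
  4 / pi * bcoef k / (2 * k).+1%:R ^+ 2 / 2 ^+ (2 * k).+1.

Lemma mahler_coef_ge0 k : (0 <= mahler_coef k)%R.
Proof.
apply: divr_ge0; last by rewrite exprn_ge0.
apply: divr_ge0; last by rewrite exprn_ge0.
by apply: mulr_ge0; [rewrite divr_ge0// pi_ge0|exact/ltW/bcoef_gt0].
Qed.

Let inner (s : R) := \int[mu]_(t in `[0%R, 1%R])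
  (6 - ln (Num.max (Normc.normc (1 + e2pi t : R[i]) ^+ 2) s))%:E.

Let msq (x : R) (D : set R) : measurable_fun D
  (fun t => ln (Num.max (2 * `|cos (pi * t)|)%R x)).
Proof.
apply/measurable_funTS; apply: measurableT_comp => //; apply: measurable_maxr => //.
apply: measurable_funM => //; apply: measurableT_comp => //.
by apply: continuous_measurable_fun => t; apply: continuous_comp; [exact: mulrl_continuous|exact: continuous_cos].
Qed.

Let ln_max_sqr (r x : R) : (0 <= r)%R -> (0 <= x)%R ->
  (ln (Num.max (r ^+ 2) (x ^+ 2)) = 2 * ln (Num.max r x))%R.
Proof.
move=> r0 x0; have -> : (Num.max (r ^+ 2) (x ^+ 2) = Num.max r x ^+ 2)%R.
  have [rx|xr] := leP r x.
    by rewrite max_r// lerXn2r.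
  by rewrite max_l// lerXn2r// ?nnegrE// ltW.
have m0 : (0 <= Num.max r x)%R by rewrite le_max r0.
move: m0; rewrite le_eqVlt => /predU1P[<-|m0]; first by rewrite expr0n/= ln0// mulr0.
by rewrite lnXn// mulr_natl.
Qed.

(** With x = sqrt s one has max(r^2, s) = max(r, x)^2 and x <= sqrt 2 < 2, so [integral_ln_max]
    applies and x^(2k+1) = s^(k+1/2). *)
Let inner_series (s : R) : (0 <= s <= 2)%R ->
  inner s + \sum_(k <oo) (mahler_coef k * s `^ (k%:R + 2^-1))%:E = 6%:E.
Proof.
move=> /andP[s0 s2]; pose x := Num.sqrt s.
have x0 : (0 <= x)%R by exact: sqrtr_ge0.
have xs : (x ^+ 2 = s)%R by rewrite sqr_sqrtr.
have x2 : (x < 2)%R.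
  rewrite -(@ltr_pXn2r _ 2)// ?nnegrE// xs (le_lt_trans s2)//; lra.
have x02 : (0 <= x < 2)%R by rewrite x0.
have ln2 : (ln (2 : R) <= 2)%R by exact: ge0_ln_le.
pose A := \int[mu]_(t in `[0%R, 1%R[) (ln 2 - ln (Num.max (2 * `|cos (pi * t)|) x))%:E.
pose S := \sum_(k <oo) (2 / pi * (bcoef k / (2 * k).+1%:R ^+ 2 * (x / 2) ^+ (2 * k).+1))%:E.
have AS : A + S = (ln 2)%:E by exact: integral_ln_max.
have term0 t : (0 <= ln 2 - ln (Num.max (2 * `|cos (pi * t)|) x))%R.
  rewrite subr_ge0 ge0_le_ln ?ler1n// ?le_max ?x0 ?orbT//.
  rewrite ge_max (ltW x2) andbT -[leRHS]mulr1 ler_pM2l//; exact: cos_max.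
have A0 : 0 <= A by apply: integral_ge0 => t _; rewrite lee_fin.
have Sk0 k : (0 <= 2 / pi * (bcoef k / (2 * k).+1%:R ^+ 2 * (x / 2) ^+ (2 * k).+1))%R.
  apply: mulr_ge0; first by rewrite divr_ge0// pi_ge0.
  apply: mulr_ge0; last by rewrite exprn_ge0// divr_ge0.
  by apply: divr_ge0; [exact/ltW/bcoef_gt0|rewrite exprn_ge0].
have S0 : 0 <= S by apply: nneseries_ge0 => k _ _; rewrite lee_fin.
have innerE : inner s = (6 - 2 * ln 2)%:E + 2%:E * A.
  rewrite /inner -integral_itv_bndo_bndc; last first.
    apply/measurable_EFinP; apply: measurable_funB => //.
    apply/measurable_funTS; apply: measurableT_comp => //; apply: measurable_maxr => //.
    apply: measurable_funX; apply: measurable_normc; apply: cmeasurableD; first exact: cmeasurable_cst.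
    exact: cmeasurable_e2pi.
  rewrite /A -ge0_integralZl_EFin//; last 2 first.
  - by move=> t _; rewrite lee_fin.
  - by apply/measurable_EFinP; apply: measurable_funB => //; exact: msq.
  have -> : (6 - 2 * ln 2)%:E = \int[mu]_(t in `[0%R, 1%R[) (6 - 2 * ln 2 : R)%:E.
    by rewrite integral_itv_cst// subr0 mulr1.
  rewrite -ge0_integralD//.
  - apply: eq_integral => t _; rewrite -EFinM -EFinD normc_onePe2pi -xs ln_max_sqr//.
    by congr EFin; ring.
  - by move=> t _; rewrite lee_fin; lra.
  - by move=> t _; rewrite mule_ge0// lee_fin.
  - apply: measurable_funeM; apply/measurable_EFinP; apply: measurable_funB => //; exact: msq.
have -> : \sum_(k <oo) (mahler_coef k * s `^ (k%:R + 2^-1))%:E = 2%:E * S.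
  rewrite -nneseriesZl; last by move=> k _; rewrite lee_fin.
  apply: eq_eseriesr => k _; rewrite -EFinM; congr EFin.
  have -> : (s `^ (k%:R + 2^-1) = x ^+ (2 * k).+1)%R.
    rewrite -powR_mulrn// /x -powR12_sqrt// -powRrM; congr powR.
    by rewrite -[(2 * k).+1%:R]natr1 natrM; field.
  rewrite expr_div_n /mahler_coef; ring.
rewrite innerE -addeA -ge0_muleDr// AS -EFinM -EFinD; congr EFin; ring.
Qed.

(** [inner_series] at s = |1 + e(t3)|, integrated in t3. In this additive form all terms are
    nonnegative, so the integral passes through the sum and the series. *)
Lemma mahler_integral_series :
  \int[mu]_(t3 in `[0%R, 1%R]) \int[mu]_(t1 in `[0%R, 1%R])
    (6 - ln (Num.max (Normc.normc (1 + e2pi t1 : R[i]) ^+ 2) (Normc.normc (1 + e2pi t3))))%:E +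
  \sum_(k <oo) ((mahler_coef k)%:E *
    \int[mu]_(t in `[0%R, 1%R]) ((2 * `|cos (pi * t)|) `^ (k%:R + 2^-1))%:E) = 6%:E.
Proof.
pose s (t : R) : R := (2 * `|cos (pi * t)|)%R.
have s02 t : (0 <= s t <= 2)%R.
  by rewrite mulr_ge0//= -[leRHS]mulr1 ler_pM2l// cos_max.
have ms (D : set R) : measurable_fun D s.
  apply/measurable_funTS; apply: measurable_funM => //; apply: measurableT_comp => //.
  by apply: continuous_measurable_fun => t; apply: continuous_comp; [exact: mulrl_continuous|exact: continuous_cos].
have mp k (D : set R) : measurable_fun D (fun t => (s t `^ (k%:R + 2^-1))%:E).
  apply/measurable_funTS/measurable_EFinP.
  by apply: (@measurableT_comp _ _ _ _ _ _ (@powR R ^~ _)) => //; exact: ms.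
have inner0 t : 0 <= inner (s t).
  apply: integral_ge0 => t1 _; rewrite lee_fin subr_ge0 (le_trans (ge0_ln_le _))//.
    by have /andP[h _] := s02 t; rewrite le_max h orbT.
  have /andP[_ h3] := s02 t; have /andP[h0 h1] := s02 t1.
  rewrite normc_onePe2pi -/(s t1) ge_max; apply/andP; split; last lra.
  rewrite (@le_trans _ _ (2 ^+ 2)%R)//; last lra.
  by rewrite lerXn2r// nnegrE.
have minner : measurable_fun setT (fun t => inner (s t)).
  pose f (z : R * R) : \bar R := (6 - ln (Num.max (s z.2 ^+ 2) (s z.1)))%:E.
  have mf : measurable_fun setT f.
    apply/measurable_EFinP; apply: measurable_funB => //; apply: measurableT_comp => //.
    apply: measurable_maxr; last by apply: measurableT_comp => //; exact: ms.
    by apply: measurable_funX; apply: measurableT_comp => //; exact: ms.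
  have f0 z : 0 <= f z.
    rewrite lee_fin subr_ge0 (le_trans (ge0_ln_le _))//.
      by have /andP[h _] := s02 z.1; rewrite le_max h orbT.
    have /andP[_ h3] := s02 z.1; have /andP[h0 h1] := s02 z.2.
    rewrite ge_max; apply/andP; split; last lra.
    rewrite (@le_trans _ _ (2 ^+ 2)%R)//; last lra.
    by rewrite lerXn2r// nnegrE.
  have := @ge0_integral_prod_measurable _ _ _ _ R mu `[0%R, 1%R] f (measurable_itv _) mf f0.
  congr measurable_fun; apply/funext => t; apply: eq_integral => t1 _.
  by rewrite /f normc_onePe2pi.
transitivity (\int[mu]_(t in `[0%R, 1%R]) (inner (s t) +
    \sum_(k <oo) (mahler_coef k * s t `^ (k%:R + 2^-1))%:E)); last first.
  transitivity (\int[mu]_(t in `[0%R, 1%R]) (6 : R)%:E).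
    by apply: eq_integral => t _; exact: inner_series.
  by rewrite integral_itv_cst// subr0 mulr1.
have term0 k t : 0 <= (mahler_coef k * s t `^ (k%:R + 2^-1))%:E.
  by rewrite lee_fin mulr_ge0 ?mahler_coef_ge0 ?powR_ge0.
have mterm k (D : set R) : measurable_fun D (fun t => (mahler_coef k * s t `^ (k%:R + 2^-1))%:E).
  by apply/measurable_EFinP; apply: measurable_funM => //; apply/measurable_EFinP; exact: mp.
rewrite [RHS]ge0_integralD; [|by []|by move=> t _; exact: inner0|exact: measurable_funTS
  |by move=> t _; apply: nneseries_ge0|]; last first.
  apply: ge0_emeasurable_sum; first by move=> k t _ _; exact: term0.
  by move=> k _; exact: mterm.
refine (congr2 adde _ _).
  by apply: eq_integral => t _; apply: eq_integral => t1 _; rewrite (normc_onePe2pi t).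
rewrite integral_nneseries//; last by move=> k; exact: mterm.
apply: eq_eseriesr => k _.
refine (esym (@ge0_integralZl_EFin _ _ _ mu _ (measurable_itv _)
  (fun t => (s t `^ (k%:R + 2^-1))%:E) _ (mp k _) _ (mahler_coef_ge0 k))).
by move=> t _; rewrite lee_fin powR_ge0.
Qed.

Definition mahler_term (k : nat) : R :=
  mahler_coef k * (2 `^ (k%:R + 2^-1) / pi) * fine (cos_moment (k%:R + 2^-1)).

Lemma mahler_term_ge0 k : (0 <= mahler_term k)%R.
Proof.
apply: mulr_ge0; last by apply: fine_ge0; exact: cos_moment_ge0.
apply: mulr_ge0; first exact: mahler_coef_ge0.
by rewrite divr_ge0 ?powR_ge0 ?pi_ge0.
Qed.

(** The double integral D and the series S are nonnegative with D + S = 6, hence both are finite,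
    and the Mahler measure 6 - D is S. *)
Lemma mahler3_series : exists2 m : R, series mahler_term @ \oo --> m &
  mahler3 (fun x1 x2 x3 : R[i] => ((1 + x1) ^+ 2 + x2 + x3)%R) = m%:E.
Proof.
have termE k : (mahler_coef k)%:E *
    \int[mu]_(t in `[0%R, 1%R]) ((2 * `|cos (pi * t)|) `^ (k%:R + 2^-1))%:E = (mahler_term k)%:E.
  rewrite integral_cos_powR -[cos_moment _]fineK ?cos_moment_fin//.
  by rewrite -!EFinM mulrA.
have := mahler_integral_series; under eq_eseriesr do rewrite termE.
set D := \int[mu]_(t3 in _) _; set S := \sum_(k <oo) _ => DS.
have S0 : 0 <= S by apply: nneseries_ge0 => k _ _; rewrite lee_fin mahler_term_ge0.
have D0 : 0 <= D.
  apply: integral_ge0 => t3 _; apply: integral_ge0 => t1 _.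
  have h t : (0 <= Normc.normc (1 + e2pi t : R[i]) <= 2)%R.
    by rewrite normc_onePe2pi mulr_ge0//= -[leRHS]mulr1 ler_pM2l// cos_max.
  rewrite lee_fin subr_ge0 (le_trans (ge0_ln_le _))//.
    by rewrite le_max normc_ge0 orbT.
  have /andP[_ h3] := h t3; have /andP[h0 h1] := h t1.
  rewrite ge_max; apply/andP; split; last lra.
  rewrite (@le_trans _ _ (2 ^+ 2)%R)//; last lra.
  by rewrite lerXn2r// nnegrE.
have Sfin : S \is a fin_num.
  by rewrite ge0_fin_numE// (@le_lt_trans _ _ 6%:E) ?ltry// -DS leeDr.
have Dfin : D \is a fin_num.
  by rewrite ge0_fin_numE// (@le_lt_trans _ _ 6%:E) ?ltry// -DS leeDl.
exists (fine S).
  have : (\sum_(0 <= k < n) (mahler_term k)%:E) @[n --> \oo] --> S.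
    by apply: is_cvg_nneseries => k _ _; rewrite lee_fin mahler_term_ge0.
  rewrite -{1}(fineK Sfin) => /fine_cvgP[_]; apply: cvg_trans; apply: near_eq_cvg.
  by apply: nearW => n; rewrite /= sumEFin.
rewrite (@mahler3_of_integral _ (fine D)); last by rewrite fineK.
have /(congr1 fine) := DS; rewrite fineD//= => DS'.
by congr EFin; rewrite -[X in (X - _)%R]DS'; ring.
Qed.

End mahler_series.

(** * Gamma values and the recurrence of the moments *)

Section gamma_values.
Context {R : realType}.
Local Open Scope ereal_scope.
Implicit Types a : R.

Lemma eGamma_sqr_fin a (v : R) : eGamma a * eGamma a = v%:E ->
  eGamma a \is a fin_num /\ (fine (eGamma a) ^+ 2 = v)%R.
Proof.
have := eGamma_ge0 a; case: (eGamma a) => [r|_|//]; last by rewrite mulyy.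
by move=> _; rewrite -EFinM => -[<-]; rewrite expr2.
Qed.

Definition gamma_half (n : nat) : R := fine (eGamma (n%:R + 2^-1)).

(** At a = 1/2 the diagonal formula reads Gamma(1/2)^2 = B(1/2, 1/2) Gamma(1), and the Beta value is
    the cosine moment of order 0. *)
Lemma gamma_half0 : eGamma (0%:R + 2^-1 : R) = (Num.sqrt pi)%:E.
Proof.
rewrite add0r; have E : eGamma (2^-1 : R) * eGamma (2^-1) = pi%:E.
  rewrite eGamma_sqr eBetaE divff// subrr powRr0 mul1e eGamma1 mule1.
  by rewrite cos_moment0.
have [f sq] := eGamma_sqr_fin E; rewrite -(fineK f) -sq sqrtr_sqr ger0_norm//.
exact/fine_ge0/eGamma_ge0.
Qed.

Lemma eGamma_half n : eGamma (n%:R + 2^-1 : R) = (gamma_half n)%:E.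
Proof.
rewrite /gamma_half fineK//; elim: n => [|n IH]; first by rewrite gamma_half0.
by rewrite -natr1 addrAC eGammaD1// fin_numM.
Qed.

Lemma gamma_halfS n : (gamma_half n.+1 = (n%:R + 2^-1) * gamma_half n)%R.
Proof.
have : (gamma_half n.+1)%:E = ((n%:R + 2^-1) * gamma_half n)%:E :> \bar R.
  by rewrite -eGamma_half -natr1 addrAC eGammaD1// eGamma_half.
by case.
Qed.

Lemma gamma_half_gt0 n : (0 < gamma_half n)%R.
Proof.
elim: n => [|n IH]; first by rewrite /gamma_half gamma_half0 sqrtr_gt0 pi_gt0.
by rewrite gamma_halfS mulr_gt0.
Qed.

Definition cosm (k : nat) : R := fine (cos_moment (k%:R + 2^-1)).

(* Chosen so that [2 * ak k - 1 = k + 1/2], the exponent in [cosm k]. *)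
Let ak (k : nat) : R := (k%:R / 2 + 3 / 4)%R.

Let gamma_ak k : eGamma (ak k) \is a fin_num /\
  (fine (eGamma (ak k)) ^+ 2 = 2 `^ (- (k%:R + 2^-1)) * cosm k * gamma_half k.+1)%R.
Proof.
apply: eGamma_sqr_fin; rewrite eGamma_sqr eBetaE.
have -> : (2 * ak k = k.+1%:R + 2^-1)%R by rewrite /ak -[k.+1%:R]natr1; field.
rewrite eGamma_half (_ : 1 - _ = - (k%:R + 2^-1))%R; last by rewrite -natr1; ring.
rewrite (_ : k.+1%:R + 2^-1 - 1 = k%:R + 2^-1)%R; last by rewrite -natr1; ring.
by rewrite -[cos_moment _]fineK ?cos_moment_fin// ltW.
Qed.

Let ak_gt0 k : (0 < ak k)%R. Proof. by rewrite ltr_wpDl// divr_ge0. Qed.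

Local Open Scope ring_scope.

(** Two steps in k raise [ak] by 1, so Gamma(a + 1)^2 = a^2 Gamma(a)^2 relates the two moments by a
    rational factor. *)
Lemma cosmSS k : cosm k.+2 = (2 * k%:R + 3) / (2 * k%:R + 5) * cosm k.
Proof.
have [f1 s1] := gamma_ak k; have [_ s2] := gamma_ak k.+2.
have akE : ak k.+2 = ak k + 1 by rewrite /ak -!natr1; field.
have k0 : 0 <= k%:R :> R by [].
have e2 : 2 `^ (- (k%:R + 2^-1)) = 4 * 2 `^ (- (k.+2%:R + 2^-1)) :> R.
  have -> : - (k%:R + 2^-1) = 2%:R + - (k.+2%:R + 2^-1) :> R by rewrite -[k.+2%:R]natr1 -natr1; ring.
  rewrite powRD_gt0// powR_mulrn//; congr (_ * _); ring.
move: s2; rewrite akE eGammaD1// fineM//= exprMn s1 !gamma_halfS e2.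
set e := 2 `^ _; set g := gamma_half k.
have e0 : e != 0 by rewrite gt_eqF// powR_gt0.
have g0 : g != 0 by rewrite gt_eqF// gamma_half_gt0.
rewrite /ak -[k.+2%:R]natr1 -[k.+1%:R]natr1 => E.
have q5 : 2 * k%:R + 5 != 0 :> R by rewrite gt_eqF//; lra.
have q3 : 2 * k%:R + 3 != 0 :> R by rewrite gt_eqF//; lra.
have q1 : 2 * k%:R + 1 != 0 :> R by rewrite gt_eqF//; lra.
have c0 : e * g * (2 * k%:R + 1) * (2 * k%:R + 3) * (2 * k%:R + 5) / 8 != 0.
  by rewrite !mulf_neq0.
apply: (mulfI c0).
transitivity (e * cosm k.+2 * ((k%:R + 1 + 1 + 2^-1) * ((k%:R + 1 + 2^-1) * ((k%:R + 2^-1) * g)))).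
  by field.
by rewrite -E; field.
Qed.

Lemma Gamma34_sqr : (Gamma (3 / 4) : R) ^+ 2 = 2 `^ (- 2^-1) * cosm 0 * (Num.sqrt pi / 2).
Proof.
have [_] := gamma_ak 0; rewrite /ak mul0r !add0r gamma_halfS /gamma_half gamma_half0/= add0r => E.
by rewrite fine_eGamma E; ring.
Qed.

(** [ak 1] is 5/4, so Gamma(1/4) = 4 Gamma(5/4); the 12 is 4^2 times the 3/4 in Gamma(5/2) = (3/4)
    sqrt pi. *)
Lemma Gamma14_sqr : (Gamma (1 / 4) : R) ^+ 2 = 2 `^ (- (3 / 2)) * cosm 1 * (12 * Num.sqrt pi).
Proof.
have [f] := gamma_ak 1; rewrite !gamma_halfS /gamma_half gamma_half0/=.
have -> : ak 1 = 1 / 4 + 1 by rewrite /ak; field.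
have -> : 1%:R + 2^-1 = 3 / 2 :> R by field.
have f14 : eGamma (1 / 4 : R) \is a fin_num.
  have : eGamma (1 / 4 + 1 : R) \is a fin_num.
    by move: f; congr (eGamma _ \is a fin_num); rewrite /ak; field.
  rewrite eGammaD1//; case: (eGamma (1 / 4)) => // /=.
    by rewrite mulry gtr0_sg// mul1e.
  by rewrite mulrNy gtr0_sg// mul1e.
rewrite eGammaD1// fineM//= exprMn -fine_eGamma => E.
transitivity (16 * ((1 / 4) ^+ 2 * (Gamma (1 / 4) : R) ^+ 2)); first by field.
by rewrite E; field.
Qed.

End gamma_values.

(** * Identification of the hypergeometric series *)

Section hypergeometric_split.
Context {R : realType}.

Lemma nonneg_series_even_odd (u : R^nat) (m : R) : (forall k, 0 <= u k) ->
  series u @ \oo --> m -> exists l1 l2 : R,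
  [/\ series (fun j => u (2 * j)%N) @ \oo --> l1,
     series (fun j => u (2 * j).+1) @ \oo --> l2 & m = l1 + l2].
Proof.
move=> u0 um.
have sE n : series (fun j => u (2 * j)%N) n + series (fun j => u (2 * j).+1) n = series u (2 * n)%N.
  rewrite /series/=; elim: n => [|n IH]; first by rewrite muln0 !big_geq// addr0.
  by rewrite mulnS !big_nat_recr//= -IH; ring.
have ub n : series u n <= m.
  rewrite -(cvg_lim (@Rhausdorff R) um); apply: nondecreasing_cvgn_le.
    by apply: nondecreasing_series => k _ _; exact: u0.
  by apply/cvg_ex; exists m.
have cv v w : (forall k, 0 <= v k) -> (forall k, 0 <= w k) ->
    (forall n, series v n + series w n = series u (2 * n)%N) -> cvgn (series v).
  move=> v0 w0 vw; apply: nondecreasing_is_cvgn.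
    by apply: nondecreasing_series => k _ _; exact: v0.
  exists m => _ [n _ <-]; rewrite (le_trans _ (ub (2 * n)%N))// -vw lerDl.
  by apply: sumr_ge0 => k _; exact: w0.
have c1 : cvgn (series (fun j => u (2 * j)%N)) by apply: cv sE.
have c2 : cvgn (series (fun j => u (2 * j).+1)).
  by apply: (cv _ (fun j => u (2 * j)%N)) => // n; rewrite addrC sE.
have [l1 h1] := (cvg_ex _).1 c1; have [l2 h2] := (cvg_ex _).1 c2.
exists l1, l2; split => //.
have h : (series u \o (fun n => 2 * n)%N) @ \oo --> l1 + l2.
  rewrite (_ : _ \o _ = (fun n => series (fun j => u (2 * j)%N) n + series (fun j => u (2 * j).+1) n)).
    exact: cvgD.
  by apply/funext => n; rewrite /= sE.
have h' : (series u \o (fun n => 2 * n)%N) @ \oo --> m.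
  apply: cvg_comp um => A [N _ NA]; exists N => // n /= Nn; apply: NA => /=.
  by rewrite (leq_trans Nn)// leq_pmull.
exact: (cvg_unique _ h' h).
Qed.

(** [hyp5F4] is a bare limit; its convergence is inherited from the series of Mahler terms, so no
    ratio test is made. *)
Lemma limn_seriesM (c l : R) (A : R^nat) :
  series (fun j => c * A j) @ \oo --> l -> c * limn (series A) = l.
Proof.
move=> cl; have E : series (fun j => c * A j) = (fun n => c * series A n).
  by apply/funext => n; rewrite /series/= mulr_sumr.
have [c0|c0] := eqVneq c 0.
  rewrite -(cvg_lim (@Rhausdorff R) cl) E c0 mul0r.
  by rewrite (_ : (fun n => _) = cst 0) ?lim_cst//; apply/funext => n; rewrite mul0r.
have : series A @ \oo --> c^-1 * l.
  rewrite (_ : series A = fun n => c^-1 * (c * series A n)).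
    by apply: cvgM; [exact: cvg_cst|rewrite -E].
  by apply/funext => n; rewrite mulKf.
by move/cvg_lim => ->//; rewrite mulVKf.
Qed.

Definition hyp_term (a1 a2 a3 a4 a5 b2 b3 b4 b5 z : R) (n : nat) : R :=
  (poch a1 n * poch a2 n * poch a3 n * poch a4 n * poch a5 n)
    / (poch b2 n * poch b3 n * poch b4 n * poch b5 n) * z ^+ n / n`!%:R.

Lemma hyp_termS (a1 a2 a3 a4 a5 b2 b3 b4 b5 z : R) n :
  hyp_term a1 a2 a3 a4 a5 b2 b3 b4 b5 z n.+1 =
  hyp_term a1 a2 a3 a4 a5 b2 b3 b4 b5 z n *
  ((a1 + n%:R) * (a2 + n%:R) * (a3 + n%:R) * (a4 + n%:R) * (a5 + n%:R) /
   ((b2 + n%:R) * (b3 + n%:R) * (b4 + n%:R) * (b5 + n%:R)) * z / n.+1%:R).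
Proof.
rewrite /hyp_term !pochS exprS factS natrM !invfM; ring.
Qed.

Lemma hyp_term0 (a1 a2 a3 a4 a5 b2 b3 b4 b5 z : R) :
  hyp_term a1 a2 a3 a4 a5 b2 b3 b4 b5 z 0 = 1.
Proof. by rewrite /hyp_term !poch0 fact0 expr0 !mulr1 !divr1. Qed.

Lemma mahler_coefSS k : mahler_coef k.+2 = mahler_coef k *
  ((2 * k%:R + 1) * (2 * k%:R + 3) / ((2 * k%:R + 2) * (2 * k%:R + 4)) *
   ((2 * k%:R + 1) / (2 * k%:R + 5)) ^+ 2 / 16) :> R.
Proof.
have k0 : 0 <= k%:R :> R by [].
rewrite /mahler_coef !bcoefS.
have -> : (2 * k.+2).+1%:R = 2 * k%:R + 5 :> R.
  by rewrite -[(2 * k.+2).+1%:R]natr1 natrM -[k.+2%:R]natr1 -[k.+1%:R]natr1; ring.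
have -> : (2 * k).+1%:R = 2 * k%:R + 1 :> R by rewrite -[(2 * k).+1%:R]natr1 natrM.
have -> : 2 ^+ (2 * k.+2).+1 = 16 * 2 ^+ (2 * k).+1 :> R.
  by rewrite !mulnS !addSn !add0n !exprS; ring.
rewrite -[k.+2%:R]natr1 -[k.+1%:R]natr1.
set e := 2 ^+ _; set b := bcoef k; move: (k%:R : R) k0 => x x0.
have e0 : e != 0 by rewrite expf_neq0.
have p0 : pi != 0 :> R by rewrite gt_eqF// pi_gt0.
move: e0 p0; move: e b (pi : R) => e b p e0 p0.
field; do ?(apply/andP; split) => //; apply: lt0r_neq0; lra.
Qed.

Lemma mahler_termSS k : mahler_term k.+2 = mahler_term k *
  ((2 * k%:R + 1) * (2 * k%:R + 3) / ((2 * k%:R + 2) * (2 * k%:R + 4)) *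
   ((2 * k%:R + 1) / (2 * k%:R + 5)) ^+ 2 * ((2 * k%:R + 3) / (2 * k%:R + 5)) / 4) :> R.
Proof.
have k0 : 0 <= k%:R :> R by [].
rewrite /mahler_term -/(cosm k.+2) -/(cosm k) cosmSS mahler_coefSS.
have -> : 2 `^ (k.+2%:R + 2^-1) = 4 * 2 `^ (k%:R + 2^-1) :> R.
  have -> : k.+2%:R + 2^-1 = 2%:R + (k%:R + 2^-1) :> R by rewrite -[k.+2%:R]natr1 -[k.+1%:R]natr1; ring.
  rewrite powRD_gt0// powR_mulrn//; congr (_ * _); ring.
set e := 2 `^ _; set c := mahler_coef k; set w := cosm k.
have p0 : pi != 0 :> R by rewrite gt_eqF// pi_gt0.
move: p0 k0; move: e c w (pi : R) (k%:R : R) => e c w p x p0 x0.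
field; do ?(apply/andP; split) => //; apply: lt0r_neq0; lra.
Qed.

(** At k = 2j the factors 2k+1, 2k+2, 2k+3, 2k+4, 2k+5 of [mahler_termSS] are 4 times j + 1/4, j +
    1/2, j + 3/4, j + 1, j + 5/4, which are the parameters and the factorial. *)
Lemma mahler_term_even j : mahler_term (2 * j) = mahler_term 0 *
  hyp_term (1 / 4) (1 / 4) (1 / 4) (3 / 4) (3 / 4) (1 / 2) (5 / 4) (5 / 4) (5 / 4) (1 / 4) j.
Proof.
elim: j => [|j IH]; first by rewrite hyp_term0 muln0 mulr1.
rewrite mulnS mahler_termSS IH hyp_termS natrM -[j.+1%:R]natr1.
have : 0 <= j%:R :> R by [].
move: (mahler_term 0) (hyp_term _ _ _ _ _ _ _ _ _ _ j) (j%:R : R) => m h x x0.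
field; do ?(apply/andP; split) => //; apply: lt0r_neq0; lra.
Qed.

(** At k = 2j + 1 the same factors are 4 times j + 3/4, j + 1, j + 5/4, j + 3/2, j + 7/4. *)
Lemma mahler_term_odd j : mahler_term (2 * j).+1 = mahler_term 1 *
  hyp_term (3 / 4) (3 / 4) (3 / 4) (5 / 4) (5 / 4) (3 / 2) (7 / 4) (7 / 4) (7 / 4) (1 / 4) j.
Proof.
elim: j => [|j IH]; first by rewrite hyp_term0 muln0 mulr1.
rewrite mulnS mahler_termSS IH hyp_termS -[(2 * j).+1%:R]natr1 natrM -[j.+1%:R]natr1.
have : 0 <= j%:R :> R by [].
move: (mahler_term 1) (hyp_term _ _ _ _ _ _ _ _ _ _ j) (j%:R : R) => m h x x0.
field; do ?(apply/andP; split) => //; apply: lt0r_neq0; lra.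
Qed.

Let pi_pow : (pi : R) `^ (5 / 2) = pi ^+ 2 * Num.sqrt pi.
Proof.
have -> : 5 / 2 = 2%:R + 2^-1 :> R by field.
by rewrite powRD_gt0 ?pi_gt0// powR_mulrn ?pi_ge0// powR12_sqrt ?pi_ge0.
Qed.

Lemma mahler_term0 : mahler_term 0 = 8 * Gamma (3 / 4) ^+ 2 / (pi `^ (5 / 2)) :> R.
Proof.
rewrite pi_pow Gamma34_sqr /mahler_term -/(cosm 0) add0r /mahler_coef bcoef0 muln0.
have -> : 2 `^ 2^-1 = 2 * 2 `^ (- 2^-1) :> R.
  rewrite -[2^-1 in LHS](_ : 1 + - 2^-1 = _); last by field.
  by rewrite powRD_gt0// powRr1.
have p0 : pi != 0 :> R by rewrite gt_eqF// pi_gt0.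
have s0 : Num.sqrt pi != 0 :> R by rewrite gt_eqF// sqrtr_gt0 pi_gt0.
move: (cosm 0) (2 `^ (- 2^-1) : R) => w e; move: s0; move: (Num.sqrt pi) => s s0.
move: p0; move: (pi : R) => p p0.
by field; apply/andP.
Qed.

(** [cosm 1] cancels on both sides. The coefficient is 1 / (36 pi), and 8 / 36 = 12 / 54 once
    2^(3/2) is written as 8 * 2^(-3/2). *)
Lemma mahler_term1 : mahler_term 1 = Gamma (1 / 4) ^+ 2 / (54 * pi `^ (5 / 2)) :> R.
Proof.
rewrite pi_pow Gamma14_sqr /mahler_term -/(cosm 1) /mahler_coef bcoefS bcoef0 muln1.
have -> : 2 `^ (1%:R + 2^-1) = 8 * 2 `^ (- (3 / 2)) :> R.
  have -> : 8 = 2 `^ 3%:R :> R by rewrite powR_mulrn//; ring.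
  by rewrite -powRD_gt0//; congr powR; field.
have p0 : pi != 0 :> R by rewrite gt_eqF// pi_gt0.
have s0 : Num.sqrt pi != 0 :> R by rewrite gt_eqF// sqrtr_gt0 pi_gt0.
move: (cosm 1) (2 `^ (- (3 / 2)) : R) => w e; move: s0; move: (Num.sqrt pi) => s s0.
move: p0; move: (pi : R) => p p0.
by field; apply/andP.
Qed.

End hypergeometric_split.

Theorem theorem3 (R : realType) :
  mahler3 (fun x1 x2 x3 : R[i] => (1 + x1) ^+ 2 + x2 + x3) =
  (8 * Gamma (3 / 4) ^+ 2 / (pi `^ (5 / 2)) *
     hyp5F4 (1 / 4) (1 / 4) (1 / 4) (3 / 4) (3 / 4)
            (1 / 2) (5 / 4) (5 / 4) (5 / 4) (1 / 4)
   + Gamma (1 / 4) ^+ 2 / (54 * pi `^ (5 / 2)) *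
     hyp5F4 (3 / 4) (3 / 4) (3 / 4) (5 / 4) (5 / 4)
            (3 / 2) (7 / 4) (7 / 4) (7 / 4) (1 / 4))%:E.
Proof.
have [m um ->] := @mahler3_series R.
have [l1 [l2 [h1 h2 ->]]] := nonneg_series_even_odd (@mahler_term_ge0 R) um.
rewrite -mahler_term0 -mahler_term1; congr (_ + _)%:E.
  apply/esym/limn_seriesM; rewrite -/(hyp_term _ _ _ _ _ _ _ _ _ _).
  by under eq_fun do rewrite -mahler_term_even.
apply/esym/limn_seriesM; rewrite -/(hyp_term _ _ _ _ _ _ _ _ _ _).
by under eq_fun do rewrite -mahler_term_odd.
Qed.
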